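(* The pure braided Thompson's group $BF$ is bi-orderable; that is, there exists a total order $<$ on the set $BF$ such that for all $a,b,c\in BF$, $a<b$ implies $ca<cb$ and $ac<bc$.
   Context: Trees: a tree means a finite rooted planar binary tree (every vertex has either $0$ or $2$ ordered children); its leaves are numbered $1,2,\dots,n$ from left to right. Attaching a caret to the $i$-th leaf means giving that leaf two children. Braids: $B_n$ is Artin's braid group on $n$ strands, generated by $\sigma_1,\dots,\sigma_{n-1}$ subject to $\sigma_i\sigma_j=\sigma_j\sigma_i$ if $|i-j|>1$ and $\sigma_i\sigma_j\sigma_i=\sigma_j\sigma_i\sigma_j$ if $|i-j|=1$. $\rho_n:B_n\to S_n$ sends a braid to the permutation it induces on the base points (the strand of $b$ starting at position $i$ ends at position $\rho_n(b)(i)$; products of braids are read from left to right). $P_n=\ker\rho_n$ is the pure braid group. Strand splitting: for $b\in B_n$ and $1\le i\le n$, let $s_i(b)\in B_{n+1}$ be the braid obtained from $b$ by replacing the strand starting at position $i$ by two parallel strands (which do not cross each other). Algebraically, $s_i(1)=1$, $s_i(ab)=s_i(a)\,s_{\rho_n(a)(i)}(b)$, and $s_i(\sigma_j)=\sigma_{j+1}$ if $i<j$, $s_j(\sigma_j)=\sigma_{j+1}\sigma_j$, $s_{j+1}(\sigma_j)=\sigma_j\sigma_{j+1}$, $s_i(\sigma_j)=\sigma_j$ if $i>j+1$. The group $BV$: its elements are equivalence classes of triples $(T_-,b,T_+)$, where $T_-,T_+$ are trees with the same number $n$ of leaves and $b\in B_n$ (the $i$-th strand of $b$ joins leaf $i$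 of $T_-$ to leaf $\rho_n(b)(i)$ of $T_+$). The equivalence relation is generated by $(T_-,b,T_+)\sim(T_-',s_i(b),T_+')$, where $T_-'$ is $T_-$ with a caret attached to leaf $i$ and $T_+'$ is $T_+$ with a caret attached to leaf $\rho_n(b)(i)$. To multiply the classes of $(T_-,b,T_+)$ and $(U_-,c,U_+)$, choose equivalent representatives $(\overline T_-,\overline b,\overline T_+)$ and $(\overline U_-,\overline c,\overline U_+)$ with $\overline T_+=\overline U_-$; the product is the class of $(\overline T_-,\overline b\,\overline c,\overline U_+)$. $BF$ is the subgroup of $BV$ of those elements represented by triples $(T_-,p,T_+)$ with $p$ a pure braid. *)

(* Defs.v *)
From HB Require Import structures.
From Stdlib Require Import Relations.
From mathcomp Require Import all_boot fingroup perm boolp zify.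
From mathcomp Require Import generic_quotient.

Set Implicit Arguments.
Unset Strict Implicit.
Unset Printing Implicit Defensive.

Local Open Scope group_scope.
Local Open Scope quotient_scope.

(* Strands, generators and leaves are numbered from 0, so that a number k here
   stands for k+1 in the usual notation. *)

Local Ltac split_ifs := repeat
  match goal with |- context [if ?c then _ else _] =>
    lazymatch c with
    | context [if _ then _ else _] => fail
    | _ => case: (boolP c) => ?; try (exfalso; lia)
    end
  end.

Definition bi_orderable (G : groupType) : Prop :=
  exists lt : rel G,
    [/\ irreflexive lt, transitive lt,
        (forall a b, a != b -> lt a b || lt b a)
      & forall a b c, lt a b -> lt (c * a) (c * b) /\ lt (a * c) (b * c)].

(* Words in the generators of B_n: (false, j) is sigma_j, (true, j) is its
   inverse; sigma_j exchanges the positions lo j = j and hi j = j + 1. *)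
Definition letter (n : nat) : Type := (bool * 'I_n.-1)%type.
Definition bword (n : nat) : Type := seq (letter n).

Definition lo n (j : 'I_n.-1) : 'I_n := widen_ord (leq_pred n) j.

Lemma hi_subproof n (j : 'I_n.-1) : j.+1 < n.
Proof. by have := ltn_ord j; lia. Qed.

Definition hi n (j : 'I_n.-1) : 'I_n := Ordinal (hi_subproof j).

Definition wgen n (j : 'I_n.-1) : bword n := [:: (false, j)].

Inductive braid_step n : bword n -> bword n -> Prop :=
| StepCancel (u v : bword n) (e : bool) (j : 'I_n.-1) :
    braid_step (u ++ [:: (e, j); (~~ e, j)] ++ v) (u ++ v)
| StepComm (u v : bword n) (j k : 'I_n.-1) : j.+1 < k ->
    braid_step (u ++ (wgen j ++ wgen k) ++ v) (u ++ (wgen k ++ wgen j) ++ v)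
| StepBraid (u v : bword n) (j k : 'I_n.-1) : k = j.+1 :> nat ->
    braid_step (u ++ (wgen j ++ wgen k ++ wgen j) ++ v)
               (u ++ (wgen k ++ wgen j ++ wgen k) ++ v).

Definition braid_eq n : rel (bword n) :=
  fun u v => `[< clos_refl_sym_trans _ (@braid_step n) u v >].

Lemma braid_eqP n (u v : bword n) :
  reflect (clos_refl_sym_trans _ (@braid_step n) u v) (braid_eq u v).
Proof. exact: asboolP. Qed.

Lemma braid_eq_refl n : reflexive (@braid_eq n).
Proof. by move=> u; apply/braid_eqP; exact: rst_refl. Qed.

Lemma braid_eq_sym n : symmetric (@braid_eq n).
Proof. by move=> u v; apply/braid_eqP/braid_eqP => h; exact: rst_sym. Qed.

Lemma braid_eq_trans n : transitive (@braid_eq n).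
Proof.
move=> v u w /braid_eqP h1 /braid_eqP h2.
by apply/braid_eqP; exact: rst_trans h1 h2.
Qed.

Canonical braid_eq_equiv n :=
  EquivRel (@braid_eq n) (@braid_eq_refl n) (@braid_eq_sym n) (@braid_eq_trans n).

Definition braid (n : nat) : Type := {eq_quot (@braid_eq n)}.

HB.instance Definition _ n := EqQuotient.on (braid n).
HB.instance Definition _ n := Choice.on (braid n).

Definition braid_of n (w : bword n) : braid n := \pi_(braid n) w.
Definition word_of n (b : braid n) : bword n := repr b.

Lemma word_ofK n (b : braid n) : braid_of (word_of b) = b.
Proof. exact: reprK. Qed.

Lemma braid_ofP n (u v : bword n) :
  braid_of u = braid_of v <-> clos_refl_sym_trans _ (@braid_step n) u v.
Proof.
split=> [|h]; first by move=> /(@eqquotP _ _ (braid n))/braid_eqP.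
by apply/(@eqquotP _ _ (braid n))/braid_eqP.
Qed.

Lemma braid_lift n (T : Type) (f : bword n -> T) :
  (forall u v, braid_step u v -> f u = f v) ->
  forall w, f (word_of (braid_of w)) = f w.
Proof.
move=> hf w; have /braid_ofP := word_ofK (braid_of w).
move: (word_of _) => w'; by elim=> [u v /hf|u|u v _ ->|u v t _ -> _ ->].
Qed.

Definition winv n (w : bword n) : bword n :=
  rev [seq (~~ l.1, l.2) | l <- w].

Lemma braid_step_cat n (a b u v : bword n) :
  braid_step u v -> braid_step (a ++ u ++ b) (a ++ v ++ b).
Proof.
case=> [u' v' e j|u' v' j k h|u' v' j k h];
  rewrite -!(catA u') !(catA a) -!(catA _ v' b) -?(catA _ (v' ++ b)).
- exact: StepCancel.
- exact: StepComm.
- exact: StepBraid.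
Qed.

Lemma braid_pi_cat n (u u' v v' : bword n) :
  braid_of u = braid_of u' -> braid_of v = braid_of v' ->
  braid_of (u ++ v) = braid_of (u' ++ v').
Proof.
move=> /braid_ofP hu /braid_ofP hv.
apply: (@etrans _ _ (braid_of (u' ++ v))); apply/braid_ofP.
- elim: hu => [a b h|a|a b _|a b c _ h1 _ h2].
  + by apply: rst_step; exact: (@braid_step_cat n [::] v).
  + exact: rst_refl.
  + exact: rst_sym.
  + exact: rst_trans h1 h2.
- elim: hv => [a b h|a|a b _|a b c _ h1 _ h2].
  + by apply: rst_step; have := @braid_step_cat n u' [::] _ _ h; rewrite !cats0.
  + exact: rst_refl.
  + exact: rst_sym.
  + exact: rst_trans h1 h2.
Qed.

Definition braid_one n : braid n := braid_of [::].
Definition braid_mul n (a b : braid n) : braid n := braid_of (word_of a ++ word_of b).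
Definition braid_inv n (a : braid n) : braid n := braid_of (winv (word_of a)).

Lemma braid_mul_pi n (u v : bword n) :
  braid_mul (braid_of u) (braid_of v) = braid_of (u ++ v).
Proof. by apply: braid_pi_cat; rewrite word_ofK. Qed.

Lemma winv_cat n (u v : bword n) : winv (u ++ v) = winv v ++ winv u.
Proof. by rewrite /winv map_cat rev_cat. Qed.

Lemma winvK n : involutive (@winv n).
Proof.
move=> w; rewrite /winv map_rev revK -map_comp -[RHS]map_id.
by apply: eq_map => -[e j] /=; rewrite negbK.
Qed.

Lemma braid_winvr n (w : bword n) : braid_of (w ++ winv w) = braid_of [::].
Proof.
elim/last_ind: w => [//|w [e j] IH].
rewrite -cats1 winv_cat -catA (catA [:: _]) -IH.
by apply/braid_ofP; apply: rst_step; exact: StepCancel.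
Qed.

Lemma braid_winvl n (w : bword n) : braid_of (winv w ++ w) = braid_of [::].
Proof. by rewrite -{2}(winvK w) braid_winvr. Qed.

Lemma braid_mulA n : associative (@braid_mul n).
Proof.
move=> a b c; rewrite -[a]word_ofK -[b]word_ofK -[c]word_ofK.
by rewrite !braid_mul_pi catA.
Qed.

Lemma braid_mul1 n : left_id (@braid_one n) (@braid_mul n).
Proof. by move=> a; rewrite -[a]word_ofK braid_mul_pi. Qed.

Lemma braid_mulr1 n : right_id (@braid_one n) (@braid_mul n).
Proof. by move=> a; rewrite -[a]word_ofK braid_mul_pi cats0. Qed.

Lemma braid_mulV n : left_inverse (@braid_one n) (@braid_inv n) (@braid_mul n).
Proof. by move=> a; rewrite -{2}[a]word_ofK braid_mul_pi braid_winvl. Qed.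

Lemma braid_mulrV n : right_inverse (@braid_one n) (@braid_inv n) (@braid_mul n).
Proof. by move=> a; rewrite -{1}[a]word_ofK braid_mul_pi braid_winvr. Qed.

HB.instance Definition _ n := isGroup.Build (braid n)
  (@braid_mulA n) (@braid_mul1 n) (@braid_mulr1 n) (@braid_mulV n) (@braid_mulrV n).

Definition sigma n (j : 'I_n.-1) : braid n := braid_of (wgen j).

Lemma braid_piM n (u v : bword n) :
  braid_of (u ++ v) = braid_of u * braid_of v.
Proof. by rewrite -braid_mul_pi. Qed.

Lemma braid_pi_letter n e (j : 'I_n.-1) :
  braid_of [:: (e, j)] = if e then (sigma j)^-1 else sigma j.
Proof.
case: e => //; apply: (mulIg (sigma j)); rewrite mulVg /sigma -braid_piM /=.
by apply/braid_ofP; apply: rst_step; exact: (StepCancel [::] [::]).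
Qed.

Lemma sigmaC n (j k : 'I_n.-1) :
  j.+1 < k -> sigma j * sigma k = sigma k * sigma j.
Proof.
move=> h; rewrite /sigma -!braid_piM; apply/braid_ofP; apply: rst_step.
exact: (StepComm [::] [::]).
Qed.

Lemma sigma_braid n (j k : 'I_n.-1) : k = j.+1 :> nat ->
  sigma j * sigma k * sigma j = sigma k * sigma j * sigma k.
Proof.
move=> h; rewrite /sigma -!braid_piM; apply/braid_ofP; apply: rst_step.
exact: (StepBraid [::] [::]).
Qed.

Lemma braid_ind n (P : braid n -> Prop) :
  P 1 -> (forall j, P (sigma j)) -> (forall a, P a -> P a^-1) ->
  (forall a b, P a -> P b -> P (a * b)) -> forall a, P a.
Proof.
move=> h1 hs hV hM a; rewrite -[a]word_ofK; elim: (word_of a) => [//|[e j] w IH].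
rewrite (braid_piM [:: _] w) braid_pi_letter; apply: hM => //.
by case: e; [apply: hV|]; apply: hs.
Qed.

Definition sigma_perm n (j : 'I_n.-1) : 'S_n := tperm (lo j) (hi j).

(* [s * t] is s followed by t for permutations, in agreement with braids being
   read from left to right; transpositions are their own inverses. *)
Definition wperm n (w : bword n) : 'S_n := \prod_(l <- w) sigma_perm l.2.

Definition rho n (b : braid n) : 'S_n := wperm (word_of b).

Definition pure n (b : braid n) : bool := rho b == 1.

Lemma sigma_permE n (j : 'I_n.-1) (i : 'I_n) :
  sigma_perm j i = (if i == j :> nat then j.+1 else if i == j.+1 :> nat then j : nat else i) :> nat.
Proof.
rewrite /sigma_perm; case: tpermP => [->|->|h1 h2] /=; first by rewrite eqxx.
- by rewrite (gtn_eqF (ltnSn j)) eqxx.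
- case: eqP => [h|_]; first by case: h1; apply: val_inj.
  by case: eqP => [h|_ //]; case: h2; apply: val_inj.
Qed.

Lemma wperm_cat n (u v : bword n) : wperm (u ++ v) = wperm u * wperm v.
Proof. exact: big_cat. Qed.

Lemma wperm1 n (l : letter n) : wperm [:: l] = sigma_perm l.2.
Proof. exact: big_seq1. Qed.

Lemma wperm_step n (u v : bword n) : braid_step u v -> wperm u = wperm v.
Proof.
case=> [u' v' e j|u' v' j k h|u' v' j k h]; rewrite !wperm_cat.
- rewrite (wperm_cat [:: _] [:: _]) !wperm1 /= /sigma_perm.
  by rewrite tperm2 mul1g.
- congr (_ * (_ * _)); rewrite !wperm1 /=; apply/permP => i; apply: val_inj.
  rewrite /= !permM !sigma_permE; split_ifs; lia.
- congr (_ * (_ * _)); rewrite !wperm1 /=; apply/permP => i; apply: val_inj.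
  rewrite /= !permM !sigma_permE; split_ifs; lia.
Qed.

Lemma rho_pi n (w : bword n) : rho (braid_of w) = wperm w.
Proof. exact: (braid_lift (@wperm_step n)). Qed.

Lemma rhoM n : {morph @rho n : a b / a * b >-> (a * b)%g}.
Proof.
by move=> a b; rewrite -[a]word_ofK -[b]word_ofK -braid_piM !rho_pi wperm_cat.
Qed.

Lemma rho1 n : rho (1 : braid n) = 1.
Proof. by rewrite -[1]/(braid_of [::]) rho_pi /wperm big_nil. Qed.

Lemma rhoV n (a : braid n) : rho a^-1 = (rho a)^-1.
Proof. by apply: (mulgI (rho a)); rewrite -rhoM !mulgV rho1. Qed.

Lemma rho_sigma n (j : 'I_n.-1) : rho (sigma j) = sigma_perm j.
Proof. by rewrite /sigma rho_pi wperm1. Qed.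

(* s_i(sigma_j); among the generators of B_(n+1), indexed by 'I_n, lo j and hi j
   are sigma_j and sigma_(j+1). *)
Definition split_gen n (j : 'I_n.-1) (i : 'I_n) : braid n.+1 :=
  if i < j then sigma (hi j : 'I_n.+1.-1)
  else if i == j :> nat then sigma (hi j : 'I_n.+1.-1) * sigma (lo j : 'I_n.+1.-1)
  else if i == j.+1 :> nat then sigma (lo j : 'I_n.+1.-1) * sigma (hi j : 'I_n.+1.-1)
  else sigma (lo j : 'I_n.+1.-1).

(* The rule for inverse letters is forced by s_i(ab) = s_i(a) s_{rho(a)(i)}(b)
   applied to sigma_j^-1 sigma_j = 1. *)
Definition split_letter n (l : letter n) (i : 'I_n) : braid n.+1 :=
  if l.1 then (split_gen l.2 (sigma_perm l.2 i))^-1 else split_gen l.2 i.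

Fixpoint split_word n (w : bword n) (i : 'I_n) : braid n.+1 :=
  if w is l :: w' then split_letter l i * split_word w' (sigma_perm l.2 i)
  else 1.

Definition strand_split n (b : braid n) (i : 'I_n) : braid n.+1 := split_word (word_of b) i.

(* Generators indexed by nat, with junk value 1 out of range, so that index
   equalities stay arithmetic. *)
Definition sg n (a : nat) : braid n :=
  if insub a : option 'I_n.-1 is Some j then sigma j else 1.

Lemma sgE n (j : 'I_n.-1) : sigma j = sg n j.
Proof. by rewrite /sg valK. Qed.

Lemma sg_commute n a b : (a.+1 < b) || (b.+1 < a) -> commute (sg n a) (sg n b).
Proof.
rewrite /sg => h; case: insubP => [j _ ja|_]; last exact/commute_sym/commute1.
case: insubP => [k _ kb|_]; last exact: commute1.
by case/orP: h => h; [|apply: commute_sym]; apply: sigmaC; move: ja kb => /= -> ->.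
Qed.

Lemma sg_braid n a : a.+1 < n.-1 ->
  sg n a * sg n a.+1 * sg n a = sg n a.+1 * sg n a * sg n a.+1.
Proof.
move=> h; have h' : a < n.-1 by lia.
by have := @sigma_braid n (Ordinal h') (Ordinal h) erefl; rewrite !sgE.
Qed.

Lemma split_genE n (j : 'I_n.-1) (i : 'I_n) : split_gen j i =
  if i < j then sg n.+1 j.+1
  else if i == j :> nat then sg n.+1 j.+1 * sg n.+1 j
  else if i == j.+1 :> nat then sg n.+1 j * sg n.+1 j.+1 else sg n.+1 j.
Proof. by rewrite /split_gen !sgE. Qed.

Lemma split_word_cat n (u v : bword n) i :
  split_word (u ++ v) i = split_word u i * split_word v (wperm u i).
Proof.
elim: u i => [|l u IH] i /=; first by rewrite mul1g /wperm big_nil perm1.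
by rewrite IH mulgA (wperm_cat [:: l] u) wperm1 permM.
Qed.

Lemma split_word_gen n (j : 'I_n.-1) i : split_word (wgen j) i = split_gen j i.
Proof. by rewrite /= mulg1. Qed.

Lemma split_gen_comm n (j k : 'I_n.-1) i : j.+1 < k ->
  split_gen j i * split_gen k (sigma_perm j i) =
  split_gen k i * split_gen j (sigma_perm k i).
Proof.
move=> h.
have [c1 c2 c3] : [/\ sg n.+1 j * sg n.+1 k = sg n.+1 k * sg n.+1 j,
  sg n.+1 j * sg n.+1 k.+1 = sg n.+1 k.+1 * sg n.+1 j
  & sg n.+1 j.+1 * sg n.+1 k.+1 = sg n.+1 k.+1 * sg n.+1 j.+1].
  by split; apply: sg_commute; lia.
rewrite !split_genE !sigma_permE; split_ifs;
  rewrite -?mulgA ?c1 ?c2 ?c3 // ?mulgA ?c1 ?c2 ?c3 -?mulgA ?c1 ?c2 ?c3 //.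
Qed.

Lemma split_gen_braid n (j k : 'I_n.-1) i : k = j.+1 :> nat ->
  split_gen j i * split_gen k (sigma_perm j i) *
    split_gen j (sigma_perm k (sigma_perm j i)) =
  split_gen k i * split_gen j (sigma_perm k i) *
    split_gen k (sigma_perm j (sigma_perm k i)).
Proof.
move=> h; have kn := ltn_ord k.
have c1 : sg n.+1 j * sg n.+1 j.+2 = sg n.+1 j.+2 * sg n.+1 j.
  by apply: sg_commute; lia.
have c2 : sg n.+1 j * sg n.+1 j.+1 * sg n.+1 j =
          sg n.+1 j.+1 * sg n.+1 j * sg n.+1 j.+1 by apply: sg_braid => /=; lia.
have c3 : sg n.+1 j.+1 * sg n.+1 j.+2 * sg n.+1 j.+1 =
          sg n.+1 j.+2 * sg n.+1 j.+1 * sg n.+1 j.+2 by apply: sg_braid => /=; lia.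
rewrite !split_genE !sigma_permE h; move: c1 c2 c3.
move: (sg n.+1 j) (sg n.+1 j.+1) (sg n.+1 j.+2) => x y z c1 c2 c3.
have c1' w : w * x * z = w * z * x by rewrite -!mulgA c1.
have c2' w : w * x * y * x = w * y * x * y by rewrite -!mulgA (mulgA x) c2 !mulgA.
have c3' w : w * y * z * y = w * z * y * z by rewrite -!mulgA (mulgA y) c3 !mulgA.
have e1 : y * x * (z * y) * x = z * (y * x) * (z * y).
  by rewrite !mulgA c1' c2' c3 -c1'.
have e2 : x * y * z * (y * x) = z * y * x * (y * z).
  by rewrite !mulgA c3' c1 -c1' c2'.
have e3 : x * (y * z) * (x * y) = y * z * (x * y) * z.
  by rewrite !mulgA -c1' c2 c3' c1'.
split_ifs; rewrite ?mulgA in e1 e2 e3 *; by [].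
Qed.

Lemma sigma_permK n (j : 'I_n.-1) : involutive (sigma_perm j).
Proof. exact: tpermK. Qed.

Lemma split_word_subst n (u v r r' : bword n) i :
  wperm r = wperm r' -> (forall k, split_word r k = split_word r' k) ->
  split_word (u ++ r ++ v) i = split_word (u ++ r' ++ v) i.
Proof. by move=> rr hr; rewrite !split_word_cat hr rr. Qed.

Lemma split_word_step n (u v : bword n) i :
  braid_step u v -> split_word u i = split_word v i.
Proof.
case=> [u' v' e j|u' v' j k h|u' v' j k h].
- apply: (@split_word_subst _ _ _ _ [::]) => [|l /=].
    exact: (@wperm_step _ _ [::] (StepCancel [::] [::] e j)).
  rewrite mulg1 /split_letter /=; case: e => /=; first by rewrite mulVg.
  by rewrite sigma_permK mulgV.
- apply: split_word_subst => [|l]; last first.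
    by rewrite !split_word_cat !split_word_gen !wperm1 split_gen_comm.
  by apply: wperm_step; have := StepComm [::] [::] h; rewrite !cats0.
- apply: split_word_subst => [|l]; last first.
    rewrite !split_word_cat !split_word_gen !wperm1 !mulgA.
    exact: split_gen_braid.
  by apply: wperm_step; have := StepBraid [::] [::] h; rewrite !cats0.
Qed.

Lemma split_braid_of n (w : bword n) i : strand_split (braid_of w) i = split_word w i.
Proof.
exact: (@braid_lift n _ (fun w => split_word w i) (fun u v => @split_word_step n u v i)).
Qed.

Lemma split1 n i : strand_split (1 : braid n) i = 1.
Proof. exact: split_braid_of. Qed.

Lemma splitM n (a b : braid n) i : strand_split (a * b) i = strand_split a i * strand_split b (rho a i).
Proof.
rewrite -[a]word_ofK -[b]word_ofK -braid_piM !split_braid_of rho_pi.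
exact: split_word_cat.
Qed.

Lemma split_sigma n (j : 'I_n.-1) i : strand_split (sigma j) i = split_gen j i.
Proof. by rewrite /sigma split_braid_of split_word_gen. Qed.

Lemma splitV n (b : braid n) i : strand_split b^-1 (rho b i) = (strand_split b i)^-1.
Proof. by apply: (mulgI (strand_split b i)); rewrite -splitM !mulgV split1. Qed.

(* [dup i k] is the position of (the first copy of) strand k once strand i has
   been doubled. *)
Definition dup n (i k : 'I_n) : 'I_n.+1 :=
  if k <= i then widen_ord (leqnSn n) k else lift ord0 k.

Lemma dupE n (i k : 'I_n) : dup i k = (if k <= i then k : nat else k.+1) :> nat.
Proof. by rewrite /dup; case: ifP. Qed.

Lemma rho_sg n a (k : 'I_n) : a < n.-1 -> rho (sg n a) k =
  (if k == a :> nat then a.+1 else if k == a.+1 :> nat then a else k : nat) :> nat.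
Proof. by move=> h; rewrite -(sgE (Ordinal h)) rho_sigma sigma_permE. Qed.

Lemma rho_split n (b : braid n) i :
  (forall k, rho (strand_split b i) (dup i k) = dup (rho b i) (rho b k)) /\
  rho (strand_split b i) (lift ord0 i) = lift ord0 (rho b i).
Proof.
elim/braid_ind: b i => [i|j i|a IH i|a b IHa IHb i].
- by rewrite split1 !rho1 !perm1; split=> // k; rewrite !perm1.
- have jn := ltn_ord j; split=> [k|]; apply: ord_inj;
    rewrite split_sigma split_genE rho_sigma ?[in RHS]dupE ?lift0 ?sigma_permE;
    split_ifs;
    rewrite ?rhoM ?permM !rho_sg ?dupE ?lift0 /=; try lia;
    split_ifs; lia.
- have [k ->] : exists k, i = rho a k by exists ((rho a)^-1 i); rewrite permKV.
  rewrite splitV !rhoV permK; have [IH1 IH2] := IH k.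
  split=> [l|]; apply: (can_inj (permK (rho (strand_split a k)))); rewrite permKV.
    by rewrite IH1 permKV.
  by rewrite IH2.
- rewrite splitM !rhoM !permM; have [a1 a2] := IHa i; have [b1 b2] := IHb (rho a i).
  by split=> [k|]; rewrite ?permM ?a1 ?b1 // a2 b2.
Qed.

Lemma rho_split_dup n (b : braid n) i k :
  rho (strand_split b i) (dup i k) = dup (rho b i) (rho b k).
Proof. by have [->] := rho_split b i. Qed.

Lemma split_sg n a (i : 'I_n) : a < n.-1 -> strand_split (sg n a) i =
  if i < a then sg n.+1 a.+1
  else if i == a :> nat then sg n.+1 a.+1 * sg n.+1 a
  else if i == a.+1 :> nat then sg n.+1 a * sg n.+1 a.+1 else sg n.+1 a.
Proof. by move=> h; rewrite -(sgE (Ordinal h)) split_sigma split_genE. Qed.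

Lemma split_split_sigma n (j : 'I_n.-1) (i k : 'I_n) : i < k ->
  strand_split (strand_split (sigma j) i) (dup i k) = strand_split (strand_split (sigma j) k) (dup k i).
Proof.
move=> ik; have jn := ltn_ord j; rewrite !split_sigma !split_genE.
have c a b : a.+1 < b -> sg n.+2 a * sg n.+2 b = sg n.+2 b * sg n.+2 a.
  by move=> h; apply: sg_commute; rewrite h.
have ei : dup i k = k.+1 :> nat by rewrite dupE; split_ifs; lia.
have ek : dup k i = i :> nat by rewrite dupE; split_ifs; lia.
have c02 := c j j.+2 (ltnSn _).
split_ifs; rewrite ?splitM !split_sg ?rho_sg /= ?ei ?ek; try lia; split_ifs => //.
move: c02; move: (sg _ j) (sg _ j.+1) (sg _ j.+2) => x y z c02.
by rewrite -!mulgA (mulgA z) -c02 !mulgA.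
Qed.

Lemma split_split n (b : braid n) (i k : 'I_n) : i != k ->
  strand_split (strand_split b i) (dup i k) = strand_split (strand_split b k) (dup k i).
Proof.
elim/braid_ind: b i k => [|j|a IH|a b IHa IHb] i k ik.
- by rewrite !split1.
- have : (i < k) || (k < i) by have : i != k :> nat by []; lia.
  by case/orP => h; [|symmetry]; apply: split_split_sigma.
- have [i' ei] : exists x, i = rho a x by exists ((rho a)^-1 i); rewrite permKV.
  have [k' ek] : exists x, k = rho a x by exists ((rho a)^-1 k); rewrite permKV.
  move: ik; rewrite ei ek (inj_eq perm_inj) => ik.
  by rewrite !splitV -!rho_split_dup !splitV IH.
- by rewrite !splitM !rho_split_dup IHa // IHb // (inj_eq perm_inj).
Qed.

Inductive tree : Type := Leaf | Node of tree & tree.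

Fixpoint nleaves (t : tree) : nat :=
  if t is Node l r then (nleaves l + nleaves r)%N else 1%N.

(* Attaching a caret to leaf i; only meaningful for i < nleaves t. *)
Fixpoint attach (t : tree) (i : nat) : tree :=
  if t is Node l r then
    if i < nleaves l then Node (attach l i) r else Node l (attach r (i - nleaves l))
  else Node Leaf Leaf.

Lemma nleaves_attach t i : nleaves (attach t i) = (nleaves t).+1.
Proof.
by elim: t i => [//|l IHl r IHr] i /=; case: ifP => _ /=; rewrite ?IHl ?IHr ?addnS.
Qed.

Lemma nleaves_gt0 t : 0 < nleaves t.
Proof. by elim: t => [//|l IHl r IHr] /=; lia. Qed.

Fixpoint tree_le (t u : tree) : bool :=
  match t, u with
  | Leaf, _ => true
  | Node l r, Node l' r' => tree_le l l' && tree_le r r'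
  | _, _ => false
  end.

Lemma tree_le_refl t : tree_le t t.
Proof. by elim: t => [//|l IHl r IHr] /=; rewrite IHl. Qed.

Lemma tree_le_trans t u v : tree_le t u -> tree_le u v -> tree_le t v.
Proof.
elim: t u v => [//|l IHl r IHr] [//|l' r'] [//|l2 r2] /= /andP[h1 h2] /andP[h3 h4].
by rewrite (IHl l' l2) // (IHr r' r2).
Qed.

Lemma tree_le_attach t i : tree_le t (attach t i).
Proof.
by elim: t i => [//|l IHl r IHr] i /=; case: ifP => _ /=; rewrite ?tree_le_refl ?IHl ?IHr.
Qed.

Lemma tree_le_nleaves t u : tree_le t u -> nleaves t <= nleaves u.
Proof.
elim: t u => [|l IHl r IHr] [|l' r'] //=; first by have := nleaves_gt0 l'; lia.
by move=> /andP[/IHl h1 /IHr h2]; lia.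
Qed.

Lemma tree_le_eq t u : tree_le t u -> nleaves t = nleaves u -> t = u.
Proof.
elim: t u => [|l IHl r IHr] [|l' r'] //=.
  by have := nleaves_gt0 l'; have := nleaves_gt0 r'; lia.
move=> /andP[h1 h2] h; have h3 := tree_le_nleaves h1; have h4 := tree_le_nleaves h2.
have el : nleaves l = nleaves l' by clear -h h3 h4; lia.
have er : nleaves r = nleaves r' by clear -h h3 h4; lia.
by rewrite (IHl _ h1 el) (IHr _ h2 er).
Qed.

Lemma tree_le_step t u : tree_le t u -> nleaves t < nleaves u ->
  exists2 i, i < nleaves t & tree_le (attach t i) u.
Proof.
elim: t u => [|l IHl r IHr] [|l' r'] //= ; first by exists 0.
move=> /andP[h1 h2] h; have [hl|hl] := ltnP (nleaves l) (nleaves l').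
  by have [i il hi] := IHl _ h1 hl; exists i; rewrite ?il /= ?hi //; lia.
have hr : nleaves r < nleaves r' by lia.
have [i ir hi] := IHr _ h2 hr; exists (nleaves l + i); first by lia.
by rewrite ltnNge leq_addr /= addKn h1.
Qed.

Lemma attachL l r i : i < nleaves l -> attach (Node l r) i = Node (attach l i) r.
Proof. by move=> /= ->. Qed.

Lemma attachR l r i :
  nleaves l <= i -> attach (Node l r) i = Node l (attach r (i - nleaves l)).
Proof. by move=> /=; rewrite ltnNge => ->. Qed.

Lemma attach_attach t i k : i < k -> k < nleaves t ->
  attach (attach t i) k.+1 = attach (attach t k) i.
Proof.
elim: t i k => [|l IHl r IHr] i k ik; first by rewrite /=; lia.
rewrite /nleaves -/nleaves => kn.
have [kl|kl] := ltnP k (nleaves l).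
  rewrite (@attachL _ _ i) ?(@attachL _ _ k) ?attachL ?nleaves_attach; try lia.
  by rewrite IHl.
rewrite [attach (Node l r) k]attachR //; have [il|il] := ltnP i (nleaves l).
  by rewrite !(@attachL l _ i il) attachR ?nleaves_attach ?subSS.
by rewrite !attachR ?subSn ?IHr //; lia.
Qed.

Lemma tree_le_attach2 t u i k : i < k -> k < nleaves t ->
  tree_le (attach t i) u -> tree_le (attach t k) u ->
  tree_le (attach (attach t k) i) u.
Proof.
elim: t u i k => [|l IHl r IHr] u i k ik; first by rewrite /=; lia.
rewrite /nleaves -/nleaves => kn.
have [kl|kl] := ltnP k (nleaves l).
  rewrite (@attachL _ _ i) ?(@attachL _ _ k) ?attachL ?nleaves_attach; try lia.
  by case: u => //= l' r' /andP[h1 ->] /andP[h2 _]; rewrite andbT IHl.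
rewrite [attach (Node l r) k]attachR //; have [il|il] := ltnP i (nleaves l).
  by rewrite !attachL //; case: u => //= l' r' /andP[-> _] /andP[_ ->].
rewrite !attachR //; case: u => //= l' r' /andP[-> h1] /andP[_ h2] /=.
by apply: IHr => //; lia.
Qed.

Fixpoint tree_join (t u : tree) : tree :=
  match t, u with
  | Leaf, _ => u
  | _, Leaf => t
  | Node l r, Node l' r' => Node (tree_join l l') (tree_join r r')
  end.

Lemma tree_joinl t u : tree_le t (tree_join t u).
Proof.
elim: t u => [//|l IHl r IHr] [|l' r'] /=; first by rewrite !tree_le_refl.
by rewrite IHl IHr.
Qed.

Lemma tree_joinr t u : tree_le u (tree_join t u).
Proof.
elim: t u => [|l IHl r IHr] [|l' r'] //=; first by rewrite !tree_le_refl.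
by rewrite IHl IHr.
Qed.

Definition tree_of (n : nat) : Type := {t : tree | nleaves t == n}.

Lemma caret_subproof n (t : tree_of n) (i : 'I_n) :
  nleaves (attach (val t) i) == n.+1.
Proof. by rewrite nleaves_attach (eqP (valP t)). Qed.

Definition caret n (t : tree_of n) (i : 'I_n) : tree_of n.+1 :=
  exist _ (attach (val t) i) (caret_subproof t i).

Definition leaf : tree_of 1 := exist _ Leaf isT.

(* The i-th strand of the braid b of (T_-, b, T_+) joins leaf i of tdom = T_- to
   leaf (rho b i) of tcod = T_+. *)
Record triple : Type := Triple {
  strands : nat;
  tdom : tree_of strands;
  tbraid : braid strands;
  tcod : tree_of strands }.

Inductive expand : triple -> triple -> Prop :=
| Expand n (T U : tree_of n) (b : braid n) (i : 'I_n) :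
    expand (Triple T b U)
           (Triple (caret T i) (strand_split b i) (caret U (rho b i))).

HB.instance Definition _ := gen_eqMixin triple.
HB.instance Definition _ := gen_choiceMixin triple.

Definition triple_eq : rel triple :=
  fun x y => `[< clos_refl_sym_trans _ expand x y >].

Lemma triple_eqP x y :
  reflect (clos_refl_sym_trans _ expand x y) (triple_eq x y).
Proof. exact: asboolP. Qed.

Lemma triple_eq_refl : reflexive triple_eq.
Proof. by move=> x; apply/triple_eqP; exact: rst_refl. Qed.

Lemma triple_eq_sym : symmetric triple_eq.
Proof. by move=> x y; apply/triple_eqP/triple_eqP => h; exact: rst_sym. Qed.

Lemma triple_eq_trans : transitive triple_eq.
Proof.
move=> y x z /triple_eqP h1 /triple_eqP h2.
by apply/triple_eqP; exact: rst_trans h1 h2.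
Qed.

Canonical triple_eq_equiv :=
  EquivRel triple_eq triple_eq_refl triple_eq_sym triple_eq_trans.

Definition BV : Type := {eq_quot triple_eq}.

HB.instance Definition _ := EqQuotient.on BV.
HB.instance Definition _ := Choice.on BV.

Definition bv_of (x : triple) : BV := \pi_BV x.
Definition triple_of (X : BV) : triple := repr X.

Lemma triple_ofK X : bv_of (triple_of X) = X.
Proof. exact: reprK. Qed.

Lemma bv_ofP x y : bv_of x = bv_of y <-> clos_refl_sym_trans _ expand x y.
Proof.
split=> [|h]; first by move=> /(@eqquotP _ _ BV)/triple_eqP.
by apply/(@eqquotP _ _ BV)/triple_eqP.
Qed.

Definition expand_at (x : triple) (i : 'I_(strands x)) : triple :=
  Triple (caret (tdom x) i) (strand_split (tbraid x) i) (caret (tcod x) (rho (tbraid x) i)).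

Lemma expandP x y : expand x y <-> exists i, y = @expand_at x i.
Proof.
split=> [[n T U b i]|[i ->]]; first by exists i.
by case: x i => n T b U i; exact: Expand.
Qed.

Inductive reach (x : triple) : triple -> Prop :=
| Reach0 : reach x x
| ReachS y z : expand x y -> reach y z -> reach x z.

Lemma reach_trans x y z : reach x y -> reach y z -> reach x z.
Proof.
move=> h; elim: h z => [//|{}x x' {}y h1 _ IH z /IH]; exact: ReachS h1.
Qed.

Lemma reach1 x y : expand x y -> reach x y.
Proof. by move=> h; apply: ReachS h _; exact: Reach0. Qed.

Lemma reach_bv x y : reach x y -> bv_of x = bv_of y.
Proof.
elim=> [//|{}x x' {}y h _ <-].
by apply/bv_ofP; apply: rst_step.
Qed.

Lemma caret_caret n (t : tree_of n) (i k : 'I_n) : i != k ->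
  caret (caret t i) (dup i k) = caret (caret t k) (dup k i).
Proof.
have tn := eqP (valP t).
have aux (a c : 'I_n) : a < c ->
    caret (caret t a) (dup a c) = caret (caret t c) (dup c a).
  move=> ac; apply: val_inj => /=; rewrite !dupE (ltnW ac) leqNgt ac /=.
  by rewrite attach_attach // tn.
move=> ik; have : (i < k) || (k < i) by have : i != k :> nat by []; lia.
by case/orP => /aux.
Qed.

Lemma expand_at_comm x (i k : 'I_(strands x)) : i != k ->
  @expand_at (expand_at i) (dup i k) = @expand_at (expand_at k) (dup k i).
Proof.
move=> ik; rewrite /expand_at /=; rewrite caret_caret // split_split //.
by rewrite !rho_split_dup (@caret_caret _ (tcod x)) // (inj_eq perm_inj).
Qed.

Lemma expand_diamond x y z : expand x y -> expand x z ->
  y = z \/ exists2 w, expand y w & expand z w.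
Proof.
move=> /expandP[i ->] /expandP[k ->].
have [->|ik] := eqVneq i k; [by left|right].
exists (@expand_at (expand_at i) (dup i k)); apply/expandP; first by eexists.
by rewrite expand_at_comm //; eexists.
Qed.

Lemma reach_strip x y z : expand x y -> reach x z ->
  exists2 w, reach y w & z = w \/ expand z w.
Proof.
move=> xy h; elim: h y xy => [{}x y xy|{}x x' {}z xx' x'z IH y xy].
  by exists y; [exact: Reach0|right].
have [->|[w yw x'w]] := expand_diamond xy xx'; first by exists z; [|left].
by have [v wv hv] := IH w x'w; exists v => //; exact: ReachS yw wv.
Qed.

Lemma reach_confl x y z : reach x y -> reach x z ->
  exists2 w, reach y w & reach z w.
Proof.
move=> h; elim: h z => [{}x z xz|{}x x' {}y xx' _ IH z xz].
  by exists z => //; exact: Reach0.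
have [w x'w hw] := reach_strip xx' xz; have [v yv wv] := IH w x'w.
by exists v => //; case: hw => [->//|zw]; exact: ReachS zw wv.
Qed.

Lemma bv_of_reach x y :
  bv_of x = bv_of y <-> exists2 z, reach x z & reach y z.
Proof.
split=> [/bv_ofP|[z /reach_bv -> /reach_bv ->//]].
elim=> [{}x {}y h|{}x|{}x {}y _ [z h1 h2]|{}x {}y z _ [u h1 h2] _ [v h3 h4]].
- by exists y; [exact: reach1|exact: Reach0].
- by exists x; exact: Reach0.
- by exists z.
- have [w uw vw] := reach_confl h2 h3.
  by exists w; [exact: reach_trans h1 uw|exact: reach_trans h4 vw].
Qed.

Lemma reach_strands x y : reach x y -> strands x <= strands y.
Proof. by elim=> [//|{}x x' {}y [n T U b i] _ /=]; lia. Qed.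

Lemma reach_cod_le x y : reach x y -> tree_le (val (tcod x)) (val (tcod y)).
Proof.
elim=> [{}x|{}x x' {}y [n T U b i] _ /= h]; first exact: tree_le_refl.
exact: tree_le_trans (tree_le_attach _ _) h.
Qed.

Lemma lift_cod x u : tree_le (val (tcod x)) u ->
  exists2 y, reach x y & val (tcod y) = u.
Proof.
have [m hm] := ubnP (nleaves u - strands x); elim: m x hm => [//|m IH] x hm xu.
have xn := eqP (valP (tcod x)).
have le := tree_le_nleaves xu; move: le; rewrite leq_eqVlt => /orP[/eqP e|lt].
  by exists x; [exact: Reach0|exact: tree_le_eq].
have [k kx hk] := tree_le_step xu lt; rewrite xn in kx.
pose i := (rho (tbraid x))^-1 (Ordinal kx).
have [||y h1 h2] := IH (expand_at i).
- by rewrite /=; lia.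
- by rewrite /= /i permKV.
- by exists y => //; apply: ReachS h1; apply/expandP; exists i.
Qed.

Lemma caret_le2 n (t : tree_of n) (i k : 'I_n) u : i != k ->
  tree_le (val (caret t i)) u -> tree_le (val (caret t k)) u ->
  tree_le (val (caret (caret t i) (dup i k))) u.
Proof.
have tn := eqP (valP t).
have aux (a c : 'I_n) : a < c ->
    tree_le (val (caret t a)) u -> tree_le (val (caret t c)) u ->
    tree_le (val (caret (caret t c) (dup c a))) u.
  by move=> ac; rewrite /= dupE (ltnW ac); apply: tree_le_attach2; rewrite ?tn.
move=> ik; have : (i < k) || (k < i) by have : i != k :> nat by []; lia.
by case/orP => h h1 h2; [rewrite caret_caret //|]; apply: aux h _ _.
Qed.

Lemma reach_cod_inj x y z : reach x y -> reach x z ->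
  val (tcod y) = val (tcod z) -> y = z.
Proof.
have [m hm] := ubnP (strands y - strands x).
elim: m x y z hm => [//|m IH] x y z hm xy xz e.
have eyz : strands y = strands z.
  by rewrite -(eqP (valP (tcod y))) -(eqP (valP (tcod z))) e.
have nstr a b : expand a b -> strands b = (strands a).+1 by case.
case: xy hm e eyz => [|x1 {}y xx1 x1y] hm e eyz.
  case: xz e eyz => [//|x2 {}z xx2 x2z] _.
  by have := reach_strands x2z; rewrite (nstr _ _ xx2); lia.
have hm1 : strands y - strands x1 < m.
  by have := reach_strands x1y; have := nstr _ _ xx1; lia.
case: xz e eyz => [|x2 {}z xx2 x2z] e eyz.
  by have := reach_strands x1y; rewrite (nstr _ _ xx1); lia.
move: (xx1) (xx2) => /expandP[i ei] /expandP[k ek].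
have [eik|ik] := eqVneq i k.
  by apply: (IH x1) => //; rewrite ei eik -ek.
have [w] : exists2 w, reach (@expand_at (expand_at i) (dup i k)) w
    & val (tcod w) = val (tcod y).
  apply: lift_cod; rewrite /= -!/(val _) rho_split_dup.
  apply: (@caret_le2 _ (tcod x)); first by rewrite (inj_eq perm_inj).
  - by have := reach_cod_le x1y; rewrite ei.
  - by rewrite e; have := reach_cod_le x2z; rewrite ek.
move=> hw ew.
have x1w : reach x1 w by apply: ReachS hw; apply/expandP; rewrite ei; eexists.
have x2w : reach x2 w.
  by move: hw; rewrite expand_at_comm // => hw; apply: ReachS hw; apply/expandP; rewrite ek; eexists.
have yw : y = w by apply: (IH x1).
rewrite yw; apply: (IH x2) => //; last by rewrite -e.
by rewrite -yw (nstr _ _ xx2) -(nstr _ _ xx1).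
Qed.

Definition tinv (x : triple) : triple := Triple (tcod x) (tbraid x)^-1 (tdom x).

Lemma tinvK : involutive tinv.
Proof. by case=> n T b U; rewrite /tinv /= invgK. Qed.

Lemma expand_tinv x y : expand x y -> expand (tinv x) (tinv y).
Proof.
case=> n T U b i; rewrite /tinv /=; apply/expandP; exists (rho b i).
by rewrite /expand_at /= splitV rhoV permK.
Qed.

Lemma reach_tinv x y : reach x y -> reach (tinv x) (tinv y).
Proof.
elim=> [{}x|{}x x' {}y /expand_tinv h _]; [exact: Reach0|exact: ReachS].
Qed.

Lemma lift_dom x u : tree_le (val (tdom x)) u ->
  exists2 y, reach x y & val (tdom y) = u.
Proof.
move=> h; have [y xy ey] := @lift_cod (tinv x) u h.
by exists (tinv y) => //; have := reach_tinv xy; rewrite tinvK.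
Qed.

Inductive tcomp : triple -> triple -> triple -> Prop :=
| TComp n (T U V : tree_of n) (b c : braid n) :
    tcomp (Triple T b U) (Triple U c V) (Triple T (b * c) V).

Lemma tcomp_ex x y : val (tcod x) = val (tdom y) -> exists z, tcomp x y z.
Proof.
case: x y => [n T b U] [m V c W] /= e.
have nm : n = m by rewrite -(eqP (valP U)) -(eqP (valP V)) /= e.
subst m; have -> : V = U by exact: val_inj (esym e).
by eexists; exact: TComp.
Qed.

Lemma tcomp_expandl x y z x' : tcomp x y z -> expand x x' ->
  exists y' z', [/\ expand y y', expand z z' & tcomp x' y' z'].
Proof.
case=> n T U V b c /expandP[i ->]; rewrite /expand_at /=.
exists (@expand_at (Triple U c V) (rho b i)).
exists (@expand_at (Triple T (b * c) V) i); rewrite /expand_at /=; split.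
- exact: Expand.
- exact: Expand.
- by rewrite splitM rhoM permM; exact: TComp.
Qed.

Lemma tcomp_expandr x y z y' : tcomp x y z -> expand y y' ->
  exists x' z', [/\ expand x x', expand z z' & tcomp x' y' z'].
Proof.
case=> n T U V b c /expandP[/= k ->]; rewrite /expand_at /=.
pose i := (rho b)^-1 k; have -> : k = rho b i by rewrite permKV.
exists (@expand_at (Triple T b U) i).
exists (@expand_at (Triple T (b * c) V) i); rewrite /expand_at /=; split.
- exact: Expand.
- exact: Expand.
- by rewrite splitM rhoM permM; exact: TComp.
Qed.

Lemma tcomp_reachl x y z x' : tcomp x y z -> reach x x' ->
  exists y' z', [/\ reach y y', reach z z' & tcomp x' y' z'].
Proof.
move=> h xx'; elim: xx' y z h => [{}x y z h|{}x x1 {}x' xx1 _ IH y z h].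
  by exists y, z; split=> //; exact: Reach0.
have [y1 [z1 [yy1 zz1 /IH[y' [z' [h1 h2 h3]]]]]] := tcomp_expandl h xx1.
by exists y', z'; split=> //; [exact: ReachS yy1 h1|exact: ReachS zz1 h2].
Qed.

Lemma tcomp_reachr x y z y' : tcomp x y z -> reach y y' ->
  exists x' z', [/\ reach x x', reach z z' & tcomp x' y' z'].
Proof.
move=> h yy'; elim: yy' x z h => [{}y x z h|{}y y1 {}y' yy1 _ IH x z h].
  by exists x, z; split=> //; exact: Reach0.
have [x1 [z1 [xx1 zz1 /IH[x' [z' [h1 h2 h3]]]]]] := tcomp_expandr h yy1.
by exists x', z'; split=> //; [exact: ReachS xx1 h1|exact: ReachS zz1 h2].
Qed.

Lemma tcomp_mid x y z : tcomp x y z -> val (tcod x) = val (tdom y).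
Proof. by case. Qed.

Lemma existT_nat_inj (P : nat -> Type) (p : nat) (q r : P p) :
  existT P p q = existT P p r -> q = r.
Proof. exact: eq_from_Tagged. Qed.

Lemma tcomp_fun x y z z' : tcomp x y z -> tcomp x y z' -> z = z'.
Proof.
case=> n T U V b c; move ex: (Triple T b U) => x'; move ey: (Triple U c V) => y' h.
case: h ex ey => m T' U' V' b' c' ex ey.
have e := congr1 strands ex; rewrite /= in e; subst m.
case: ex ey => e1 e2 _ [_ e3 e4].
rewrite (existT_nat_inj e1) (existT_nat_inj e2) (existT_nat_inj e3).
by rewrite (existT_nat_inj e4).
Qed.

Lemma tcomp_class x y z x' y' z' : tcomp x y z -> tcomp x' y' z' ->
  bv_of x = bv_of x' -> bv_of y = bv_of y' -> bv_of z = bv_of z'.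
Proof.
move=> h h' /bv_of_reach[u xu x'u] ey.
have [y1 [z1 [yy1 zz1 h1]]] := tcomp_reachl h xu.
have [y1' [z1' [yy1' zz1' h1']]] := tcomp_reachl h' x'u.
have /bv_of_reach[w y1w y1'w] : bv_of y1 = bv_of y1'.
  by rewrite -(reach_bv yy1) -(reach_bv yy1').
have [v [z2 [uv z1z2 h2]]] := tcomp_reachr h1 y1w.
have [v' [z2' [uv' z1z2' h2']]] := tcomp_reachr h1' y1'w.
have e : v = v' by apply: reach_cod_inj uv uv' _; rewrite (tcomp_mid h2) (tcomp_mid h2').
subst v'; rewrite (reach_bv zz1) (reach_bv z1z2) (reach_bv zz1') (reach_bv z1z2').
by rewrite (tcomp_fun h2 h2').
Qed.

Lemma tcomp_reach_ex x y :
  exists x' y' z, [/\ reach x x', reach y y' & tcomp x' y' z].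
Proof.
have [x' xx' ex] := lift_cod (tree_joinl (val (tcod x)) (val (tdom y))).
have [y' yy' ey] := lift_dom (tree_joinr (val (tcod x)) (val (tdom y))).
have [z h] : exists z, tcomp x' y' z by apply: tcomp_ex; rewrite ex ey.
by exists x', y', z.
Qed.

Lemma bv_mul_subproof (X Y : BV) :
  exists z, exists x y, [/\ bv_of x = X, bv_of y = Y & tcomp x y z].
Proof.
have [x [y [z [hx hy h]]]] := tcomp_reach_ex (triple_of X) (triple_of Y).
by exists z, x, y; rewrite -(reach_bv hx) -(reach_bv hy) !triple_ofK.
Qed.

Definition bv_one : BV :=
  bv_of (Triple leaf 1 leaf).

(* The triple chosen by cid is immaterial, by tcomp_class; see bv_mulE. *)
Definition bv_mul (X Y : BV) : BV := bv_of (sval (cid (bv_mul_subproof X Y))).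
Definition bv_inv (X : BV) : BV := bv_of (tinv (triple_of X)).

Lemma bv_mulE x y z : tcomp x y z -> bv_mul (bv_of x) (bv_of y) = bv_of z.
Proof.
move=> h; rewrite /bv_mul; case: cid => z' /= [x' [y' [ex ey h']]].
exact: tcomp_class h' h ex ey.
Qed.

Lemma bv_invE x : bv_inv (bv_of x) = bv_of (tinv x).
Proof.
rewrite /bv_inv; have /bv_of_reach[z h1 h2] := triple_ofK (bv_of x).
by rewrite (reach_bv (reach_tinv h1)) (reach_bv (reach_tinv h2)).
Qed.

Lemma bv_oneE n (T : tree_of n) : bv_of (Triple T 1 T) = bv_one.
Proof.
pose isid x := exists n (U : tree_of n), x = Triple U 1 U.
have idr x y : reach x y -> isid x -> isid y.
  elim=> [//|{}x x' {}y h _ IH [m [U ex]]]; apply: IH.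
  move: h; rewrite ex => /expandP[/= i ->]; exists m.+1, (caret U i).
  by rewrite /expand_at /= split1 rho1 perm1.
have [//|y h ey] := @lift_cod (Triple leaf 1 leaf) (val T).
rewrite /bv_one (reach_bv h).
have [|m [U e]] := idr _ _ h; first by exists 1%N, leaf.
rewrite e in ey *; rewrite /= in ey.
have mn : m = n by rewrite -(eqP (valP U)) -(eqP (valP T)) /= -ey.
by subst m; have -> : U = T by exact: val_inj.
Qed.

Lemma bv_mulA : associative bv_mul.
Proof.
move=> X Y Z; rewrite -[X]triple_ofK -[Y]triple_ofK -[Z]triple_ofK.
move: (triple_of X) (triple_of Y) (triple_of Z) => x y z.
have [y1 [z1 [yz [hy hz c1]]]] := tcomp_reach_ex y z.
have [x1 [y2 [xy [hx hy2 c2]]]] := tcomp_reach_ex x y1.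
have [z2 [yz2 [hz2 _ c3]]] := tcomp_reachl c1 hy2.
rewrite (reach_bv hx) (reach_bv hy) (reach_bv hy2) (reach_bv hz) (reach_bv hz2).
case: c2 c3 {hx hy hy2 hz hz2} => n T U V b c.
move ey: (Triple U c V) => y' h; case: h ey => m U' V' W c' d ey.
have e := congr1 strands ey; rewrite /= in e; subst m.
case: ey => e1 e2 e3.
rewrite -(existT_nat_inj e1) -(existT_nat_inj e2) -(existT_nat_inj e3).
by rewrite !(bv_mulE (TComp _ _ _ _ _)) mulgA.
Qed.

Lemma bv_mul1 : left_id bv_one bv_mul.
Proof.
move=> X; rewrite -[X]triple_ofK; case: (triple_of X) => n T b U.
by rewrite -(bv_oneE T) (bv_mulE (TComp _ _ _ _ _)) mul1g.
Qed.

Lemma bv_mulr1 : right_id bv_one bv_mul.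
Proof.
move=> X; rewrite -[X]triple_ofK; case: (triple_of X) => n T b U.
by rewrite -(bv_oneE U) (bv_mulE (TComp _ _ _ _ _)) mulg1.
Qed.

Lemma bv_mulV : left_inverse bv_one bv_inv bv_mul.
Proof.
move=> X; rewrite -[X]triple_ofK bv_invE; case: (triple_of X) => n T b U.
by rewrite /tinv /= (bv_mulE (TComp _ _ _ _ _)) mulVg bv_oneE.
Qed.

Lemma bv_mulrV : right_inverse bv_one bv_inv bv_mul.
Proof.
move=> X; rewrite -[X]triple_ofK bv_invE; case: (triple_of X) => n T b U.
by rewrite /tinv /= (bv_mulE (TComp _ _ _ _ _)) mulgV bv_oneE.
Qed.

HB.instance Definition _ :=
  isGroup.Build BV bv_mulA bv_mul1 bv_mulr1 bv_mulV bv_mulrV.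

Definition pure_bv : {pred BV} := fun X =>
  `[< exists n (T U : tree_of n) (p : braid n), pure p /\ X = bv_of (Triple T p U) >].

Lemma pure_reach x y : reach x y -> pure (tbraid x) -> pure (tbraid y).
Proof.
elim=> [//|{}x x' {}y h _ IH px]; apply: IH.
case: h px => n T U b i /= /eqP pb; apply/eqP/permP => k; rewrite perm1.
have [h1 h2] := rho_split b i; rewrite pb perm1 in h1 h2.
have [->//|ki] := eqVneq k (lift ord0 i).
pose l := if k <= i then (k : nat) else k.-1.
have ln : l < n.
  have := ltn_ord k; have := ltn_ord i; rewrite /l; split_ifs; lia.
have -> : k = dup i (Ordinal ln).
  apply: ord_inj; rewrite dupE /= /l.
  have : k != i.+1 :> nat by [].
  split_ifs; lia.
by rewrite h1 perm1.
Qed.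

Lemma pure_bvP x : bv_of x \in pure_bv <->
  exists2 y, reach x y & pure (tbraid y).
Proof.
split=> [/asboolP[n [T [U [p [pp /bv_of_reach[y xy py]]]]]]|[y xy py]].
  by exists y => //; exact: pure_reach py pp.
apply/asboolP; exists (strands y), (tdom y), (tcod y), (tbraid y); split=> //.
by rewrite (reach_bv xy); case: (y).
Qed.

Lemma pure_bv_closed : group_closed pure_bv.
Proof.
split=> [|X Y].
  apply/pure_bvP; exists (Triple leaf 1 leaf); first exact: Reach0.
  by rewrite /pure /= rho1.
rewrite -[X]triple_ofK -[Y]triple_ofK; move: (triple_of X) (triple_of Y) => x y.
move=> /pure_bvP[x1 hx px] /pure_bvP[y1 hy py].
have [x2 [y2 [z [hx2 hy2 h]]]] := tcomp_reach_ex x1 (tinv y1).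
rewrite (reach_bv hx) (reach_bv hy) (reach_bv hx2).
have -> : (bv_of y1)^-1 = bv_of y2 by rewrite -(reach_bv hy2) -bv_invE.
have -> : bv_of x2 * bv_of y2 = bv_of z by exact: bv_mulE.
apply/pure_bvP; exists z; first exact: Reach0.
have {px} := pure_reach hx2 px.
have : pure (tbraid (tinv y1)) by move: py; rewrite /pure /= rhoV invg_eq1.
move=> /(pure_reach hy2).
case: h => n T U V b c /=; rewrite /pure rhoM => /eqP -> /eqP ->.
by rewrite mulg1.
Qed.

Record BF : Type := InBF { bf_val :> BV; _ : bf_val \in pure_bv }.

HB.instance Definition _ := [isSub for bf_val].
HB.instance Definition _ := [Choice of BF by <:].
HB.instance Definition _ := SubChoice_isSubGroup.Build BV pure_bv BF pure_bv_closed.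

(* Main.v *)
From HB Require Import structures.
From mathcomp Require Import all_boot order fingroup perm all_algebra boolp zify.
Require Import Defs.

(* An element of BF is compared with another one through representatives
   (T, p, U) and (T, q, V) with a common first tree: first U and V by the
   lexicographic order on the depths of their leaves, which is the classical
   bi-order of Thompson's group F (the first slope that differs decides), and then,
   if U = V, the pure braids p and q.  So one needs bi-orders of the groups P_n for
   which every strand splitting P_n -> P_(n+1) is increasing.

   A braid acts on tuples of elements of a group G by Artin's (Hurwitz) action; a
   pure braid conjugates the i-th colour by its i-th longitude.  With the Magnus
   colours 1 + X_i the longitudes of p are invertible power series, and p < q means
   that the first nonzero coefficient of the difference of the two families of
   longitudes is positive, for the order on (degree, strand, monomial).  Longitudes
   satisfy a cocycle rule, in which the colours change only by terms of higher
   degree; hence multiplication does not affect leading coefficients.  Splitting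
   strand i replaces the colour 1 + X_i by (1 + X_i)(1 + X_(i+1)), i.e., X_i by
   X_i + X_(i+1) in leading terms, which preserves first coefficients.

   The order is total because longitudes determine a pure braid: by combing, a pure
   braid on n + 1 strands is a word in the loops of the last strand around the
   others, times a braid on n strands; when the last colour is trivial, the last
   longitude is that word evaluated in the free group. *)

Set Implicit Arguments.
Unset Strict Implicit.
Unset Printing Implicit Defensive.

Import Order.TTheory GRing.Theory Num.Theory.

Local Open Scope group_scope.

Local Ltac split_ifs := repeat
  match goal with |- context [if ?c then _ else _] =>
    lazymatch c with
    | context [if _ then _ else _] => fail
    | _ => case: (boolP c) => ?; try (exfalso; lia)
    end
  end.

(** * Lexicographic comparison of leaf depths *)

Definition lexlt (s t : seq nat) : bool := (s < t :> seqlexi nat)%O.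

Lemma lexlt_irr s : lexlt s s = false.
Proof. exact: ltxx. Qed.

Lemma lexlt_trans : transitive lexlt.
Proof. exact: (@lt_trans _ (seqlexi nat)). Qed.

Lemma lexlt_total s t : [|| lexlt s t, s == t | lexlt t s].
Proof.
have [->|st] := eqVneq s t; first by rewrite orbT.
exact: (@lt_total _ (seqlexi nat)).
Qed.

Lemma lexlt_cons x y s t :
  lexlt (x :: s) (y :: t) = (x < y) || (x == y) && lexlt s t.
Proof. by rewrite /lexlt ltxi_cons !leEnat; case: ltngtP. Qed.

Lemma lexlt_nil s : lexlt s [::] = false.
Proof. exact: ltxis0. Qed.

Fixpoint depths (d : nat) (t : tree) : seq nat :=
  if t is Node l r then depths d.+1 l ++ depths d.+1 r else [:: d].

Lemma size_depths d t : size (depths d t) = nleaves t.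
Proof. by elim: t d => [//|l IHl r IHr] d /=; rewrite size_cat IHl IHr. Qed.

Lemma depths_head d t : exists k s, depths d t = (d + k)%N :: s.
Proof.
elim: t d => [|l IHl r _] d; first by exists 0, [::]; rewrite addn0.
by have [k [s /= ->]] := IHl d.+1; exists k.+1, (s ++ depths d.+1 r); rewrite addSnnS.
Qed.

(** Depth lists form a prefix code: the first entry is [d] for a leaf and at least [d.+1] for a
    node, so the tree can be read off the front of any list. *)
Lemma depths_parse d t t' r r' :
  depths d t ++ r = depths d t' ++ r' -> t = t' /\ r = r'.
Proof.
elim: t t' d r r' => [|t1 IH1 t2 IH2] [|t1' t2'] d r r' /=.
- by case.
- by have [k [s ->]] := depths_head d.+1 t1'; case=> /=; lia.
- by have [k [s ->]] := depths_head d.+1 t1; case=> /=; lia.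
- by rewrite -!catA => /IH1[-> /IH2[-> ->]].
Qed.

Lemma depths_inj d : injective (depths d).
Proof.
by move=> t t' e; have [] := @depths_parse d t t' [::] [::] (congr1 (cat^~ _) e).
Qed.

(** The effect of a caret at leaf [i] on a list of leaf data: [f] is [S] for depths and [bump2] for
    pairs of depths. *)
Fixpoint bump_at (T : Type) (f : T -> T) (i : nat) (s : seq T) : seq T :=
  match s, i with
  | x :: s', 0 => [:: f x, f x & s']
  | x :: s', i'.+1 => x :: bump_at f i' s'
  | [::], _ => [::]
  end.

Lemma bump_at_cat T (f : T -> T) i s t : bump_at f i (s ++ t) =
  if i < size s then bump_at f i s ++ t else s ++ bump_at f (i - size s) t.
Proof.
elim: s i => [|x s IH] [|i] //=; rewrite ?subn0 //.
by rewrite ltnS IH subSS; case: ifP.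
Qed.

Lemma depths_attach d t i :
  i < nleaves t -> depths d (attach t i) = bump_at S i (depths d t).
Proof.
elim: t d i => [|l IHl r IHr] d i /=; first by case: i.
move=> h; rewrite bump_at_cat size_depths.
by case: ltnP => h' /=; [rewrite IHl|rewrite IHr //; lia].
Qed.

Lemma lexlt_bump i s t : size s = size t -> i < size s ->
  lexlt s t -> lexlt (bump_at S i s) (bump_at S i t).
Proof.
elim: s t i => [//|x s IH] [//|y t] [|i] /= [e]; rewrite !lexlt_cons !ltnS => h.
  by case/orP=> [->//|/andP[/eqP -> ->]]; rewrite !eqxx !orbT.
by case/orP=> [->//|/andP[-> /(IH _ i e h) ->]]; rewrite orbT.
Qed.

(** * Pairs of depths and their common refinements *)

Definition bump2 (p : nat * nat) : nat * nat := (p.1.+1, p.2.+1).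

(** The tree [t] hangs below two matching leaves of depths [p.1] and [p.2], so each of its leaves
    deepens both coordinates equally. *)
Fixpoint refine (t : tree) (p : nat * nat) : seq (nat * nat) :=
  if t is Node l r then refine l (bump2 p) ++ refine r (bump2 p) else [:: p].

Lemma refine_head t p : exists k s, refine t p = ((p.1 + k)%N, (p.2 + k)%N) :: s.
Proof.
elim: t p => [|l IHl r _] p; first by exists 0, [::]; rewrite !addn0; case: p.
have [k [s /= ->]] := IHl (bump2 p); exists k.+1, (s ++ refine r (bump2 p)).
by rewrite /= !addSnnS.
Qed.

Lemma refine_parse p t t' r r' :
  refine t p ++ r = refine t' p ++ r' -> r = r'.
Proof.
have refine1 u q : unzip1 (refine u q) = depths q.1 u.
  elim: u q => [//|u1 IH1 u2 IH2] q; rewrite /unzip1 /= map_cat.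
  by congr (_ ++ _); [exact: IH1|exact: IH2].
move=> h; have : depths p.1 t ++ unzip1 r = depths p.1 t' ++ unzip1 r'.
  by rewrite -!refine1 /unzip1 -!map_cat h.
move=> /depths_parse[e _]; move: h; rewrite e.
by elim: (refine t' p) => //= a s IH [/IH].
Qed.

Inductive refines : seq (nat * nat) -> seq (nat * nat) -> Prop :=
| RefinesNil : refines [::] [::]
| RefinesCons t p L M : refines L M -> refines (p :: L) (refine t p ++ M).

Lemma refines_refl L : refines L L.
Proof. by elim: L => [|p L IH]; [left|exact: (RefinesCons Leaf p IH)]. Qed.

Lemma refines_consI p L M : refines (p :: L) M ->
  exists t M', M = refine t p ++ M' /\ refines L M'.
Proof.
move e: (p :: L) => L' h; case: h e => [//|t q {}L' M' h [-> ->]].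
by exists t, M'.
Qed.

Lemma refines_bump i L M : refines (bump_at bump2 i L) M -> refines L M.
Proof.
elim: L i M => [|p L IH] [|i] M //=; last first.
  by move=> /refines_consI[t [M' [-> /IH h]]]; right.
move=> /refines_consI[t [M1 [-> /refines_consI[t' [M2 [-> h]]]]]].
by rewrite catA; exact: (RefinesCons (Node t t')).
Qed.

(* A pair (a, b) records the depths of matching leaves of the two trees of a tree
   pair, so that a - b is the logarithm of a slope.  Two tree pairs with a common
   refinement represent the same element of Thompson's group F, hence have the
   same slope on the first leaf on which their domains differ. *)
Lemma refines_lexlt L L' M : refines L M -> refines L' M ->
  lexlt (unzip1 L) (unzip1 L') -> lexlt (unzip2 L) (unzip2 L').
Proof.
move=> h; elim: h L' => {L M} [|t p L M h IH] [|p' L'] h'; rewrite ?lexlt_irr ?lexlt_nil //.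
have [t' [M' [e h1]]] := refines_consI h'; rewrite /= !lexlt_cons.
have [k [s hs]] := refine_head t p; have [k' [s' hs']] := refine_head t' p'.
(* The first pair of the common refinement lies [k] below [p] and [k'] below [p'], so [p] and [p']
   have the same difference of coordinates. *)
have [e1 e2 _] : [/\ (p.1 + k = p'.1 + k')%N, (p.2 + k = p'.2 + k')%N & s ++ M = s' ++ M'].
  by move: e; rewrite hs hs' => -[].
case/orP=> [lt1|/andP[/eqP e3 lt]]; first by apply/orP; left; lia.
have pp' : p = p' by case: (p) (p') e1 e2 e3 => [a b] [a' b'] /= *; congr (_, _); lia.
by apply/orP; right; rewrite pp' eqxx /= IH //; move: e; rewrite pp' => /refine_parse ->.
Qed.

(** * Artin's action and longitudes *)

(** Without the bounds on indices, braids on different numbers of strands act on the same tuples,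
    indexed by all naturals. *)
Definition nat_word n (w : bword n) : seq (bool * nat) :=
  [seq (l.1, nat_of_ord l.2) | l <- w].

(* In a strand (i, g) the label i remembers where the strand started and g is its
   longitude; a strand labelled i carries the group element [col i ^ g], and the
   strand passing below q is multiplied by the element that q carries. *)
Section Action.
Variables (G : groupType) (col : nat -> G).

Definition carried (p : nat * G) : G := col p.1 ^ p.2.
Definition pass_under (e : bool) (p q : nat * G) : nat * G :=
  (p.1, if e then p.2 * (carried q)^-1 else p.2 * carried q).

Definition act_letter (t : nat -> nat * G) (l : bool * nat) (k : nat) : nat * G :=
  let: (e, a) := l in
  if k == a then (if e then pass_under e (t a.+1) (t a) else t a.+1)
  else if k == a.+1 then (if e then t a else pass_under e (t a) (t a.+1))
  else t k.

Definition act_word (w : seq (bool * nat)) (t : nat -> nat * G) := foldl act_letter t w.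
Definition act n (b : braid n) (t : nat -> nat * G) := act_word (nat_word (word_of b)) t.

Lemma act_word_cat u v t : act_word (u ++ v) t = act_word v (act_word u t).
Proof. exact: foldl_cat. Qed.

(** This self-distributivity of conjugation is the third Reidemeister move for the action. *)
Lemma pass_under_dist p q r : pass_under false (pass_under false p q) r =
  pass_under false (pass_under false p r) (pass_under false q r).
Proof.
congr (_, _); rewrite -[LHS]mulgA -[RHS]mulgA; congr (_ * _).
by rewrite [carried (pass_under _ q r)]conjgM; exact: conjgC.
Qed.

Lemma act_word_step n (u v : bword n) : braid_step u v ->
  act_word (nat_word u) = act_word (nat_word v).
Proof.
case=> [u' v' e j|u' v' j k h|u' v' j k h]; apply/funext => t;
  rewrite /nat_word !map_cat !act_word_cat; congr (act_word _ _);
  move: (act_word _ t) => {}t; apply/funext => i /=.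
- case: e => /=; split_ifs; try (have -> : i = j by lia);
   try (have -> : i = j.+1 by lia);
   rewrite /pass_under /carried /= ?mulgK ?mulgVK -?surjective_pairing //.
- split_ifs => //.
- rewrite h /=; split_ifs => //; try (have -> : i = j by lia).
  exact: pass_under_dist.
Qed.

Lemma act_of n (w : bword n) t : act (braid_of w) t = act_word (nat_word w) t.
Proof. exact: (braid_lift (fun u v h => congr1 (@^~ t) (act_word_step h))). Qed.

Lemma act1 n t : act (1 : braid n) t = t.
Proof. exact: act_of. Qed.

Lemma actM n (a b : braid n) t : act (a * b) t = act b (act a t).
Proof.
rewrite -[a]word_ofK -[b]word_ofK -braid_piM !act_of.
by rewrite /nat_word map_cat act_word_cat.
Qed.

Lemma act_gen n (j : 'I_n.-1) e t :
  act (if e then (sigma j)^-1 else sigma j) t = act_letter t (e, j : nat).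
Proof. by rewrite -braid_pi_letter act_of. Qed.

Lemma act_sg n a t : a < n.-1 -> act (sg n a) t = act_letter t (false, a).
Proof. by move=> h; rewrite -(sgE (Ordinal h)) (act_gen _ false). Qed.

Lemma act_sgV n a t : a < n.-1 -> act (sg n a)^-1 t = act_letter t (true, a).
Proof. by move=> h; rewrite -(sgE (Ordinal h)) (act_gen _ true). Qed.

Lemma act_label n (b : braid n) t (i : 'I_n) : (act b t (rho b i)).1 = (t i).1.
Proof.
elim/braid_ind: b t i => [t i|j t i|a IH t i|a b IHa IHb t i].
- by rewrite act1 rho1 perm1.
- rewrite (act_gen _ false) rho_sigma sigma_permE /=; split_ifs => //;
    by congr (t _).1; lia.
- have [k ->] : exists k, i = rho a k by exists ((rho a)^-1 i); rewrite permKV.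
  by rewrite rhoV permK -(IH (act a^-1 t)) -actM mulVg act1.
- by rewrite actM rhoM permM IHb IHa.
Qed.

Lemma act_above n (b : braid n) t k : n <= k -> act b t k = t k.
Proof.
move=> nk; elim/braid_ind: b t => [t|j t|a IH t|a b IHa IHb t].
- by rewrite act1.
- by have jn := ltn_ord j; rewrite (act_gen _ false) /=; split_ifs.
- by rewrite -(IH (act a^-1 t)) -actM mulVg act1.
- by rewrite actM IHb IHa.
Qed.

(** The index [k] is a final position; by [act_pure] it is also the label of the strand when [b] is
    pure. *)
Definition longitude n (b : braid n) (k : nat) : G := (act b (fun i => (i, 1)) k).2.

Lemma longitude1 n k : longitude (1 : braid n) k = 1.
Proof. by rewrite /longitude act1. Qed.

Lemma act_pure n (b : braid n) k : pure b ->
  act b (fun i => (i, 1)) k = (k, longitude b k).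
Proof.
move=> /eqP pb; rewrite [LHS]surjective_pairing; congr (_, _).
have [kn|nk] := ltnP k n; last by rewrite act_above.
by have := act_label b (fun i => (i, 1)) (Ordinal kn); rewrite pb perm1.
Qed.

End Action.

(* Relational parametricity of the action: it yields naturality in the group,
   compatibility with congruences, and the cocycle rule below. *)
Lemma act_rel (G H : groupType) (col : nat -> G) (col' : nat -> H)
    (Q : nat * G -> nat * H -> Prop) :
  (forall e p q p' q', Q p p' -> Q q q' ->
     Q (pass_under col e p q) (pass_under col' e p' q')) ->
  forall n (b : braid n) t t', (forall k, Q (t k) (t' k)) ->
  forall k, Q (act col b t k) (act col' b t' k).
Proof.
move=> hQ n b; rewrite /act; elim: (nat_word _) => [|[e a] w IH] t t' h k //=.
apply: IH => i /=; case: ifP => _; [|case: ifP => _]; case: e => //; exact: hQ.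
Qed.

(** Longitudes are words in the colours, so a relation that respects the group operations passes
    from the colours to them. *)
Lemma longitude_rel (G H : groupType) (col : nat -> G) (col' : nat -> H)
    (E : G -> H -> Prop) :
  E 1 1 -> (forall u u' v v', E u u' -> E v v' -> E (u * v) (u' * v')) ->
  (forall u u', E u u' -> E u^-1 u'^-1) -> (forall i, E (col i) (col' i)) ->
  forall n (b : braid n) k, E (longitude col b k) (longitude col' b k).
Proof.
move=> E1 EM EV Ecol n b k; rewrite /longitude.
suff : (act col b (fun i => (i, 1)) k).1 = (act col' b (fun i => (i, 1)) k).1
  /\ E (act col b (fun i => (i, 1)) k).2 (act col' b (fun i => (i, 1)) k).2.
  by case.
refine (@act_rel _ _ _ _ (fun p p' => p.1 = p'.1 /\ E p.2 p'.2) _ n b _ _ _ k) => //.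
move=> e p q p' q' [e1 h1] [e2 h2].
have hv : E (carried col q) (carried col' q').
  by rewrite /carried !conjgE e2; apply: (EM); [exact: EV|exact: EM].
by split=> //=; case: e; apply: EM => //; exact: EV.
Qed.

(** After [a], strand [i] carries [col i ^ longitude col a i]. From there [b] acts as on fresh
    strands of these colours, with the longitudes of [a] as left factors. *)
Lemma longitudeM (G : groupType) (col : nat -> G) n (a b : braid n) k :
  pure a -> pure b -> longitude col (a * b) k =
  longitude col a k * longitude (fun i => col i ^ longitude col a i) b k.
Proof.
move=> pa pb; rewrite {1}/longitude actM.
set g := longitude col a; pose col' i := col i ^ g i; rewrite -[X in _ = _ * longitude X _ _]/col'.
have -> : act col a (fun i => (i, 1)) = fun i => (i, g i).
  by apply/funext => i; rewrite act_pure.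
suff [h1 ->] : (act col b (fun i => (i, g i)) k).1 = (act col' b (fun i => (i, 1)) k).1 /\
  (act col b (fun i => (i, g i)) k).2 =
  g (act col' b (fun i => (i, 1)) k).1 * (act col' b (fun i => (i, 1)) k).2.
  by rewrite act_pure.
refine (@act_rel _ _ _ _ (fun p p' => p.1 = p'.1 /\ p.2 = g p'.1 * p'.2) _ n b _ _ _ k)
  => [|i] /=; last first.
  by rewrite mulg1.
move=> e p q p' q' [e1 h1] [e2 h2]; split=> //=.
by rewrite /carried e2 h2 h1 /col' conjgM; case: e; rewrite -[LHS]mulgA.
Qed.

(** * Strand splitting *)

Section Splitting.
Variables (G : groupType) (col col' : nat -> G).

Let same (p' p : nat * G) := p'.2 = p.2 /\ col' p'.1 = col p.1.
(** Both copies have the longitude of the original strand and their colours multiply to its colour,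
    so passing under both has the effect of passing under the original. *)
Let doubled (p' p'' p : nat * G) :=
  [/\ p'.2 = p.2, p''.2 = p.2 & col p.1 = col' p'.1 * col' p''.1].

Let carried_same p' p : same p' p -> carried col' p' = carried col p.
Proof. by rewrite /carried => -[-> ->]. Qed.

Let carried_doubled p' p'' p : doubled p' p'' p ->
  carried col p = carried col' p' * carried col' p''.
Proof. by rewrite /carried => -[-> -> ->]; exact: conjMg. Qed.

Let same_under e p' p q' q : same p' p -> same q' q ->
  same (pass_under col' e p' q') (pass_under col e p q).
Proof. by move=> [h1 h2] /carried_same h; split; rewrite /= ?h ?h1. Qed.

Let doubled_under e p' p'' p q' q : doubled p' p'' p -> same q' q ->
  doubled (pass_under col' e p' q') (pass_under col' e p'' q') (pass_under col e p q).
Proof. by move=> [h1 h2 h3] /carried_same h; split; rewrite /= ?h ?h1 ?h2. Qed.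

Let same_under_doubled p' p q' q'' q : same p' p -> doubled q' q'' q ->
  same (pass_under col' false (pass_under col' false p' q') q'') (pass_under col false p q).
Proof.
by move=> [h1 h2] /carried_doubled h; split; rewrite //= h h1 -[LHS]mulgA.
Qed.

Let same_under_doubledV p' p q' q'' q : same p' p -> doubled q' q'' q ->
  same (pass_under col' true (pass_under col' true p' q'') q') (pass_under col true p q).
Proof.
move=> [h1 h2] /carried_doubled h.
by split; rewrite //= h h1 [(_ * carried _ _)^-1]invgM -[LHS]mulgA.
Qed.

Definition split_rel (i : nat) (t t' : nat -> nat * G) : Prop :=
  [/\ forall k, k < i -> same (t' k) (t k), doubled (t' i) (t' i.+1) (t i)
    & forall k, i < k -> same (t' k.+1) (t k)].

(** The same list serves for a generator and its inverse: inversion reverses the two letters, but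
    also exchanges the cases [i = a] and [i = a.+1]. *)
Definition split_indices (a i : nat) : seq nat :=
  if i < a then [:: a.+1] else if i == a then [:: a.+1; a]
  else if i == a.+1 then [:: a; a.+1] else [:: a].

Lemma split_rel_letter e (a i : nat) t t' : split_rel i t t' ->
  split_rel (if i == a then a.+1 else if i == a.+1 then a else i)
    (act_letter col t (e, a)) (act_word col' [seq (e, k) | k <- split_indices a i] t').
Proof.
move=> [lti eqi gti]; rewrite /split_indices.
have [ia|ai|ai] := ltngtP i a.
- rewrite (_ : i == a.+1 = false); last by lia.
  split=> [k ki||k ki] /=; case: e => /=; split_ifs;
    by [exact: eqi|apply: lti; lia|apply: gti; lia|apply: same_under; apply: gti; lia].
- have [ea|na] := eqVneq i a.+1.
    rewrite ea in lti eqi gti *.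
    split=> [k ki||k ki] /=; case: e => /=; split_ifs;
      by [exact: eqi|apply: lti; lia|apply: gti; lia|apply: doubled_under => //; apply: lti; lia
         |apply: same_under_doubled => //; apply: lti; lia].
  split=> [k ki||k ki] /=; case: e => /=; split_ifs;
    by [exact: eqi|apply: lti; lia|apply: gti; lia|apply: same_under; apply: lti; lia].
- rewrite ai in lti eqi gti *.
  split=> [k ki||k ki] /=; case: e => /=; split_ifs;
    by [exact: eqi|apply: lti; lia|apply: gti; lia|apply: doubled_under => //; apply: gti; lia
       |apply: same_under_doubledV => //; apply: gti; lia].
Qed.

Lemma split_rel_act n (b : braid n) (i : 'I_n) t t' : split_rel i t t' ->
  split_rel (rho b i) (act col b t) (act col' (strand_split b i) t').
Proof.
have letterE e (j : 'I_n.-1) (k : 'I_n) s :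
    act col' (strand_split (if e then (sigma j)^-1 else sigma j) k) s =
    act_word col' [seq (e, m) | m <- split_indices j k] s.
  have jn := ltn_ord j; have kn := ltn_ord k.
  case: e.
    have -> : k = rho (sigma j) (sigma_perm j k) by rewrite rho_sigma sigma_permK.
    rewrite splitV split_sigma split_genE rho_sigma sigma_permK sigma_permE /split_indices.
    by split_ifs; rewrite ?invgM ?actM !act_sgV //=; lia.
  by rewrite split_sigma split_genE /split_indices; split_ifs;
    rewrite ?actM !act_sg //=; lia.
rewrite -[b]word_ofK; elim: (word_of b) i t t' => [|[e j] w IH] i t t' h.
  by rewrite split1 !act1 rho1 perm1.
rewrite (braid_piM [:: _]) splitM rhoM permM !actM; apply: IH.
rewrite braid_pi_letter letterE act_gen.
have -> : rho (if e then (sigma j)^-1 else sigma j) = sigma_perm j.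
  by case: e; rewrite ?rhoV rho_sigma // /sigma_perm tpermV.
by rewrite sigma_permE; exact: split_rel_letter.
Qed.

End Splitting.

(** Splitting amounts to giving strand [i] the product of the two colours; positions [i] and [i.+1]
    of the split braid both come from strand [i]. *)
Lemma longitude_split (G : groupType) (col' : nat -> G) n (b : braid n) (i : 'I_n) k :
  pure b ->
  longitude col' (strand_split b i) k =
  longitude (fun j => if j < i then col' j else
                      if j == i :> nat then col' i * col' i.+1 else col' j.+1)
            b (if k <= i then k else k.-1).
Proof.
move=> /eqP pb; set col := fun j => _.
have : split_rel col col' i (fun k => (k, 1)) (fun k => (k, 1)).
  by rewrite /col; split=> [j ji||j ji] /=; split; rewrite //=; split_ifs.
move=> /(split_rel_act b); rewrite pb perm1 -!/(longitude _ _ _) => -[lti [e1 e2 _] gti].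
rewrite /longitude; case: (ltngtP k i) => [/lti[]//|ik|->//].
have [->//|ki] := eqVneq k i.+1; have /gti[] : i < k.-1 by lia.
by rewrite prednK //; lia.
Qed.

(** * Noncommutative power series *)

Local Open Scope ring_scope.

Section Series.

(* Noncommutative formal power series in variables X_0, X_1, ...: the coefficient
   of a monomial is indexed by the word of its variables. *)
Definition series : Type := seq nat -> int.

HB.instance Definition _ := gen_eqMixin series.
HB.instance Definition _ := gen_choiceMixin series.

Implicit Types (f g h : series) (w : seq nat).

Definition series_add f g : series := fun w => f w + g w.
Definition series_opp f : series := fun w => - f w.

Fact series_addA : associative series_add.
Proof. by move=> f g h; apply/funext => w; exact: addrA. Qed.
Fact series_addC : commutative series_add.
Proof. by move=> f g; apply/funext => w; exact: addrC. Qed.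
Fact series_add0 : left_id ((fun=> 0) : series) series_add.
Proof. by move=> f; apply/funext => w; exact: add0r. Qed.
Fact series_addN : left_inverse ((fun=> 0) : series) series_opp series_add.
Proof. by move=> f; apply/funext => w; exact: addNr. Qed.

HB.instance Definition _ :=
  GRing.isZmodule.Build series series_addA series_addC series_add0 series_addN.

(** Left division by a variable: [f] is [f [::]] plus the sum of the X_a times [tails f a]. *)
Definition tails f (a : nat) : series := fun w => f (a :: w).

(** The Cauchy product, summed over the splittings of [w] into a word for [f] followed by a word for
    [g]. *)
Fixpoint series_mul f g w : int :=
  if w is a :: w' then f [::] * g w + series_mul (tails f a) g w' else f [::] * g [::].

Definition series_one : series := fun w => (w == [::])%:R.

Fact series_mulDl : left_distributive (series_mul : series -> series -> series) series_add.
Proof.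
move=> f g h; apply/funext => w; rewrite /series_add.
elim: w f g => [|a w IH] f g /=; first by rewrite mulrDl.
by rewrite mulrDl (IH (tails f a) (tails g a)) addrACA.
Qed.

Fact series_mulDr : right_distributive (series_mul : series -> series -> series) series_add.
Proof.
move=> f g h; apply/funext => w; rewrite /series_add.
elim: w f => [|a w IH] f /=; first by rewrite mulrDr.
by rewrite mulrDr IH addrACA.
Qed.

Fact series_mulZl (c : int) f g w :
  series_mul (fun v => c * f v) g w = c * series_mul f g w.
Proof.
elim: w f => [|a w IH] f /=; first by rewrite mulrA.
by rewrite mulrDr mulrA; congr (_ + _); exact: IH.
Qed.

Fact series_mulA : associative (series_mul : series -> series -> series).
Proof.
move=> f g h; apply/funext => w; elim: w f => [|a w IH] f /=; first by rewrite mulrA.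
have -> : tails (series_mul f g) a =
    series_add (fun v => f [::] * tails g a v) (series_mul (tails f a) g) by [].
rewrite series_mulDl /series_add series_mulZl -IH.
by rewrite mulrDr mulrA addrA.
Qed.

Fact series_mul1 : left_id series_one (series_mul : series -> series -> series).
Proof.
move=> f; apply/funext => w; case: w => [|a w] /=; rewrite mul1r //.
rewrite -[RHS]addr0; congr (_ + _).
have -> : tails series_one a = fun v => 0 * series_one v.
  by apply/funext => v; rewrite mul0r.
by rewrite series_mulZl mul0r.
Qed.

Fact series_mulr1 : right_id series_one (series_mul : series -> series -> series).
Proof.
move=> f; apply/funext => w; elim: w f => [|a w IH] f /=; rewrite ?mulr1 //.
by rewrite mulr0 add0r IH.
Qed.

HB.instance Definition _ := GRing.Zmodule_isPzRing.Build series
  series_mulA series_mul1 series_mulr1 series_mulDl series_mulDr.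

Lemma coefD f g w : (f + g) w = f w + g w. Proof. by []. Qed.
Lemma coefN f w : (- f) w = - f w. Proof. by []. Qed.
Lemma coef1 w : (1 : series) w = (w == [::])%:R. Proof. by []. Qed.
Lemma coefM0 f g : (f * g) [::] = f [::] * g [::]. Proof. by []. Qed.
Lemma coefM_cons f g a w :
  (f * g) (a :: w) = f [::] * g (a :: w) + (tails f a * g) w.
Proof. by []. Qed.

Lemma coef_sum (I : Type) (r : seq I) (F : I -> series) w :
  (\sum_(i <- r) F i) w = \sum_(i <- r) F i w.
Proof. by elim: r => [|i r IH]; rewrite ?big_nil // !big_cons coefD IH. Qed.

Lemma coefMz f (c : int) w : (f *~ c) w = f w * c.
Proof.
rewrite -mulrzz; have coefMn k : (f *+ k) w = f w *+ k.
  by elim: k => [//|k IH]; rewrite !mulrS coefD IH.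
by case: c => k; rewrite -?NegzE /intmul ?coefN coefMn.
Qed.

Lemma tailsD f g a : tails (f + g) a = tails f a + tails g a.
Proof. by []. Qed.

Lemma tailsM f g a : tails (f * g) a = tails g a *~ f [::] + tails f a * g.
Proof.
by apply/funext => w; rewrite {1}/tails coefM_cons coefD coefMz mulrC.
Qed.

Definition cong (m : nat) f g : Prop := forall w, (size w < m)%N -> f w = g w.

Lemma cong_refl m f : cong m f f. Proof. by []. Qed.
Lemma cong_sym m f g : cong m f g -> cong m g f. Proof. by move=> h w /h. Qed.
Lemma cong_trans m f g h : cong m f g -> cong m g h -> cong m f h.
Proof. by move=> h1 h2 w hw; rewrite h1 ?h2. Qed.

Lemma cong_le m m' f g : (m' <= m)%N -> cong m f g -> cong m' f g.
Proof. by move=> le h w hw; apply: h; exact: leq_trans le. Qed.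

Lemma cong_add m f f' g g' : cong m f f' -> cong m g g' -> cong m (f + g) (f' + g').
Proof. by move=> h1 h2 w hw; rewrite !coefD h1 ?h2. Qed.

Lemma cong_sum (I : Type) (r : seq I) m (F F' : I -> series) :
  (forall i, cong m (F i) (F' i)) -> cong m (\sum_(i <- r) F i) (\sum_(i <- r) F' i).
Proof. by move=> h w hw; rewrite !coef_sum; apply: eq_bigr => i _; exact: h. Qed.

Lemma cong_mul m f f' g g' : cong m f f' -> cong m g g' -> cong m (f * g) (f' * g').
Proof.
move=> hf hg w; elim: w m f f' hf hg => [|a w IH] [|m] f f' hf hg //= hw.
  by rewrite !coefM0 hf ?hg.
rewrite !coefM_cons hf // hg //; congr (_ + _); apply: (IH m) => // [v hv|].
  exact: hf.
exact: cong_le hg.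
Qed.

Lemma coefM_leadr f g w : cong (size w) g 0 -> (f * g) w = f [::] * g w.
Proof.
case: w => [//|a w] h; rewrite coefM_cons.
suff -> : (tails f a * g) w = (tails f a * 0) w by rewrite mulr0 addr0.
exact: (cong_mul (cong_refl (m := (size w).+1) _) h).
Qed.

Lemma coefM_leadl f g w : cong (size w) f 0 -> (f * g) w = f w * g [::].
Proof.
elim: w f => [//|a w IH] f h; rewrite coefM_cons h // mul0r add0r IH //.
by move=> v hv; exact: h.
Qed.

(** * Substitution of series without constant term *)

Section Substitution.
Variables (n : nat) (Y : nat -> series).
Hypothesis Y0 : forall j, Y j [::] = 0.

(* Substitution of Y_j for X_j (and 0 for X_j with n <= j), correct up to
   degree k. *)
Fixpoint subst (k : nat) f : series :=
  if k is k'.+1 then 1 *~ f [::] + \sum_(j < n) Y j * subst k' (tails f j) else 0.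

Lemma substD k f g : subst k (f + g) = subst k f + subst k g.
Proof.
elim: k f g => [|k IH] f g /=; first by rewrite addr0.
rewrite mulrzDr addrACA -big_split; congr (_ + _); apply: eq_bigr => j _ /=.
by rewrite tailsD IH mulrDr.
Qed.

Lemma subst0 k : subst k 0 = 0.
Proof. by apply: (addIr (subst k 0)); rewrite -substD !add0r. Qed.

Lemma substN k f : subst k (- f) = - subst k f.
Proof. by apply: (addIr (subst k f)); rewrite -substD !addNr subst0. Qed.

Lemma substMz k f c : subst k (f *~ c) = subst k f *~ c.
Proof.
have substMn i : subst k (f *+ i) = subst k f *+ i.
  by elim: i => [|i IH]; rewrite ?subst0 // !mulrS substD IH.
by case: c => i; rewrite /intmul ?substN substMn.
Qed.

Lemma cong_mulY k j f g : cong k f g -> cong k.+1 (Y j * f) (Y j * g).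
Proof.
move=> h [|a w] hw; first by rewrite !coefM0 Y0 !mul0r.
by rewrite !coefM_cons Y0 !mul0r !add0r; exact: (cong_mul (cong_refl _) h).
Qed.

Lemma subst_stable k f : cong k (subst k f) (subst k.+1 f).
Proof.
elim: k f => [//|k IH] f; apply: cong_add => //; apply: cong_sum => j.
exact: cong_mulY.
Qed.

Lemma subst1 k : cong k (subst k 1) 1.
Proof.
case: k => [//|k] /=; rewrite big1 ?addr0 // => j _.
have -> : tails 1 j = 0 by [].
by rewrite subst0 mulr0.
Qed.

Lemma substM k f g : cong k (subst k (f * g)) (subst k f * subst k g).
Proof.
elim: k f g => [//|k IH] f g.
have -> : subst k.+1 f * subst k.+1 g = subst k.+1 g *~ f [::] +
    \sum_(j < n) Y j * (subst k (tails f j) * subst k.+1 g).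
  rewrite {1}/subst -/subst mulrDl mulrzl; congr (_ + _).
  by rewrite mulr_suml; apply: eq_bigr => j _; rewrite mulrA.
have -> : subst k.+1 (f * g) = subst k.+1 g *~ f [::] +
    \sum_(j < n) Y j * subst k (tails f j * g).
  rewrite /subst -/subst coefM0 mulrzDl -addrA mulrC mulrzA; congr (_ + _).
  rewrite mulrz_suml -big_split; apply: eq_bigr => j _ /=.
  by rewrite tailsM substD substMz mulrDr mulrzAr.
apply: cong_add => //; apply: cong_sum => j; apply: cong_mulY.
(* The induction hypothesis gives [subst k g] in place of [subst k.+1 g]; they agree below degree
   [k], which suffices after multiplication by [Y j]. *)
apply: cong_trans (IH _ _) _; apply: cong_mul => //; exact: subst_stable.
Qed.

Lemma subst_vanish k m f : cong m f 0 -> cong m (subst k f) 0.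
Proof.
elim: k m f => [//|k IH] [//|m] f h; rewrite /= h // mulr0z add0r.
apply: (@cong_trans _ _ (\sum_(j < n) (0 : series))); last by rewrite big1.
apply: cong_sum => j; rewrite -(mulr0 (Y j)); apply: cong_mulY; apply: IH => w hw.
exact: h.
Qed.

(** In the lowest degree only the linear parts of the [Y j] matter: X_j becomes the sum of the X_a
    with [c a = j], so [w] arises from [map c w] alone. The support condition makes both sides 0
    when [c] sends a letter of [w] out of range. *)
Lemma subst_lead (c : nat -> nat) k f w :
  (forall j a, (j < n)%N -> Y j [:: a] = (c a == j)%:R) ->
  (forall v, ~~ all (gtn n) v -> f v = 0) ->
  cong (size w) f 0 -> (size w < k)%N -> subst k f w = f (map c w).
Proof.
move=> Y1; elim: w k f => [|a w IH] [//|k] f supp van /= hw.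
  rewrite coefD coefMz mul1r coef_sum big1 ?addr0 // => j _.
  by rewrite coefM0 Y0 mul0r.
rewrite coefD coefMz mul0r add0r coef_sum.
transitivity (\sum_(j < n) (c a == j)%:R * subst k (tails f j) w).
  apply: eq_bigr => j _; rewrite coefM_cons Y0 mul0r add0r coefM_leadr.
    by rewrite /tails Y1.
  by apply: subst_vanish => v hv; exact: van.
have [ca|ca] := ltnP (c a) n.
  rewrite (bigD1 (Ordinal ca)) //= eqxx mul1r big1 => [|j jc].
    rewrite addr0 IH // => v hv; last exact: van.
    by apply: supp; rewrite /= ca.
  by rewrite (_ : c a == j = false) ?mul0r //; apply/eqP => e; case/eqP: jc; apply: val_inj.
rewrite big1 => [|j _]; last first.
  by rewrite (_ : c a == j = false) ?mul0r //; have := ltn_ord j; lia.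
by rewrite supp //= ltnNge ca.
Qed.

End Substitution.

End Series.

(** * The group of units of a ring *)

Section Units.
Variable R : pzRingType.

Definition units : Type := {p : R * R | (p.1 * p.2 == 1) && (p.2 * p.1 == 1)}.
HB.instance Definition _ := Choice.on units.

Definition uval (u : units) : R := (val u).1.
Definition uinv (u : units) : R := (val u).2.

Lemma uvalK u : uval u * uinv u = 1. Proof. by case/andP: (valP u) => /eqP. Qed.
Lemma uinvK u : uinv u * uval u = 1. Proof. by case/andP: (valP u) => _ /eqP. Qed.

Lemma uval_inj : injective uval.
Proof.
move=> u v e; apply: val_inj; rewrite [val u]surjective_pairing [val v]surjective_pairing.
congr (_, _); first exact: e.
rewrite -/(uinv u) -/(uinv v) -[LHS]mulr1 -(uvalK v) mulrA.
by rewrite -e uinvK mul1r.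
Qed.

Definition mk_unit (x y : R) (xy : x * y = 1) (yx : y * x = 1) : units :=
  exist _ (x, y) (introT andP (conj (introT eqP xy) (introT eqP yx))).

Definition unit_one : units := mk_unit (mul1r 1) (mul1r 1).
Definition unit_inv (u : units) : units := mk_unit (uinvK u) (uvalK u).

Fact unit_mul_subproof (u v : units) : uval u * uval v * (uinv v * uinv u) = 1.
Proof. by rewrite mulrA -(mulrA (uval u)) uvalK mulr1 uvalK. Qed.
Fact unit_mul_subproof' (u v : units) : uinv v * uinv u * (uval u * uval v) = 1.
Proof. by rewrite mulrA -(mulrA (uinv v)) uinvK mulr1 uinvK. Qed.
Definition unit_mul u v : units := mk_unit (unit_mul_subproof u v) (unit_mul_subproof' u v).

Fact unit_mulA : associative unit_mul.
Proof. by move=> u v w; apply: uval_inj; exact: mulrA. Qed.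
Fact unit_mul1 : left_id unit_one unit_mul.
Proof. by move=> u; apply: uval_inj; exact: mul1r. Qed.
Fact unit_mulr1 : right_id unit_one unit_mul.
Proof. by move=> u; apply: uval_inj; exact: mulr1. Qed.
Fact unit_mulV : left_inverse unit_one unit_inv unit_mul.
Proof. by move=> u; apply: uval_inj; exact: uinvK. Qed.
Fact unit_mulrV : right_inverse unit_one unit_inv unit_mul.
Proof. by move=> u; apply: uval_inj; exact: uvalK. Qed.

HB.instance Definition _ :=
  isGroup.Build units unit_mulA unit_mul1 unit_mulr1 unit_mulV unit_mulrV.

Lemma uval1 : uval 1%g = 1. Proof. by []. Qed.
Lemma uvalM (u v : units) : uval (u * v)%g = uval u * uval v. Proof. by []. Qed.
Lemma uvalVK (u : units) : uval u^-1%g * uval u = 1. Proof. exact: uinvK. Qed.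
Lemma uvalKV (u : units) : uval u * uval u^-1%g = 1. Proof. exact: uvalK. Qed.

End Units.

(** * The Magnus units 1 + X_j *)

Definition var (j : nat) : series := fun w => (w == [:: j])%:R.

(** The geometric series of -X_j: the coefficient is (-1)^k on the k-th power of X_j and 0 on other
    words. *)
Fixpoint var_inv_coef (j : nat) (w : seq nat) : int :=
  if w is a :: w' then (if a == j then - var_inv_coef j w' else 0) else 1.
Definition var_inv j : series := var_inv_coef j.

Lemma coefM_var j (f : series) a w :
  ((1 + var j) * f) (a :: w) = f (a :: w) + (a == j)%:R * f w.
Proof.
rewrite coefM_cons -[LHS]/(1 * _ + _) mul1r; congr (_ + _).
have -> : tails (1 + var j) a = 1 *~ (a == j)%:R.
  apply/funext => v; rewrite /tails coefD coefMz coef1 /var eqseq_cons /=.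
  rewrite add0r; case: eqP => //= _; by rewrite ?mulr1 ?mulr0.
by rewrite mulrzl coefMz mulrC.
Qed.

Fact var_unitr j : (1 + var j) * var_inv j = 1.
Proof.
apply/funext => -[|a w]; first by rewrite coefM0 coefD.
rewrite coefM_var /var_inv /=; case: eqP => _; rewrite ?mul0r ?addr0 //.
by rewrite mul1r addNr.
Qed.

Fact var_unitl j : var_inv j * (1 + var j) = 1.
Proof.
apply/funext => w; elim: w => [|a w IH]; first by rewrite coefM0 coefD.
have -> : (var_inv j * (1 + var j)) (a :: w) =
    (1 + var j) (a :: w) - (a == j)%:R * (var_inv j * (1 + var j)) w.
  rewrite coefM_cons mul1r; congr (_ + _).
  have -> : tails (var_inv j) a = var_inv j *~ - (a == j)%:R.
    apply/funext => v; rewrite coefMz /tails /var_inv /=.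
    by case: (a == j); rewrite ?oppr0 ?mulr0 // mulrN mulr1.
  by rewrite mulrzAl coefMz mulrN mulrC.
rewrite IH coefD !coef1 /var eqseq_cons add0r.
by case: (a == j); rewrite ?mul1r ?mul0r ?subrr.
Qed.

Definition unit_var (j : nat) : units series := mk_unit (var_unitr j) (var_unitl j).

Lemma uval_var j : uval (unit_var j) = 1 + var j. Proof. by []. Qed.

(* Over nonrepeating words, (1 + X_j)^-1 behaves like 1 - X_j. *)
Lemma coefM_unit_var (e : bool) j (f : series) a w :
  sorted (fun x y => x != y) (a :: w) ->
  (uval (if e then (unit_var j)^-1 else unit_var j)%g * f) (a :: w) =
  f (a :: w) + (-1) ^+ e * (a == j)%:R * f w.
Proof.
case: e => alt; last by rewrite [LHS]coefM_var expr0 mul1r.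
(* Writing [f] as (1 + X_j) f' reduces to the positive case; when [a = j], the word [w] does not
   begin with [j], whence [f w = f' w]. *)
set f' := _ * f; have ff' : f = (1 + var j) * f'.
  by rewrite /f' mulrA [X in X * _](uvalKV (unit_var j)) mul1r.
have -> : f (a :: w) = f' (a :: w) + (a == j)%:R * f' w by rewrite {1}ff' coefM_var.
rewrite -mulrA; have -> : (a == j)%:R * f w = (a == j)%:R * f' w.
  have [aj|_] := eqVneq a j; rewrite ?mul0r ?mul1r // ff'.
  case: w alt => [_|b w /= /andP[ab _]]; first by rewrite coefM0 mul1r.
  by rewrite coefM_var -aj eq_sym (negPf ab) mul0r addr0.
by rewrite expr1 mulN1r addrK.
Qed.

Local Close Scope ring_scope.

(** * Magnus embedding of free groups *)

Definition letter_eval (G : groupType) (h : nat -> G) (l : bool * nat) : G :=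
  if l.1 then (h l.2)^-1 else h l.2.

Fixpoint word_eval (G : groupType) (h : nat -> G) (w : seq (bool * nat)) : G :=
  if w is l :: w' then letter_eval h l * word_eval h w' else 1.

Lemma word_eval_cat (G : groupType) (h : nat -> G) u v :
  word_eval h (u ++ v) = word_eval h u * word_eval h v.
Proof. by elim: u => [|l u IH] /=; rewrite ?mul1g // IH mulgA. Qed.

Definition reduced_rel (l l' : bool * nat) : bool := (l.2 != l'.2) || (l.1 == l'.1).

Lemma not_sortedP (T : Type) (r : rel T) s : ~~ sorted r s ->
  exists u x y v, s = u ++ [:: x, y & v] /\ ~~ r x y.
Proof.
elim: s => [//|x [//|y s] IH] /=; rewrite negb_and => /orP[rxy|/IH].
  by exists [::], x, y, s.
by move=> [u [a [b [v [-> h]]]]]; exists (x :: u), a, b, v.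
Qed.

(** The word [l.2 :: a] lists the generators of the successive runs, and no longer nonrepeating
    monomial occurs in [f]. A letter continuing the first run has the same exponent, as the word is
    reduced, so it adds to the coefficient a term of the same sign; the positivity clause records
    that nothing cancels. *)
Lemma reduced_coef l w : sorted reduced_rel (l :: w) ->
  let f := uval (word_eval unit_var (l :: w)) in
  exists a, [/\ sorted (fun x y => x != y) (l.2 :: a), f a != 0%R,
    (0 < (-1) ^+ l.1 * f a * f (l.2 :: a))%R
    & forall x u, sorted (fun x y => x != y) (x :: u) ->
      (size a <= size u)%N -> (x != l.2) || (size a < size u)%N -> f (x :: u) = 0%R].
Proof.
elim: w l => [|l' w IH] [e j] red f; rewrite {}/f.
  have fE a w : sorted (fun x y => x != y) (a :: w) ->
      uval (word_eval unit_var [:: (e, j)]) (a :: w) =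
      ((1 : series) (a :: w) + (-1) ^+ e * (a == j)%:R * (1 : series) w)%R by exact: coefM_unit_var.
  exists [::]; rewrite fE // eqxx /= !coef1 add0r !mulr1; split=> // [||x u alt _ h].
  - by case: (e).
  - by case: (e).
  rewrite fE // !coef1 add0r; case: u h {alt} => [|y u] /=; last by rewrite mulr0.
  by rewrite orbF => /negPf ->; rewrite mulr0 mul0r.
have {IH} [a []] := IH l' (path_sorted red).
move: red => /= /andP[/orP red _].
set f := uval (word_eval unit_var (l' :: w)); set f1 := uval _.
have fE x u : sorted (fun x y => x != y) (x :: u) ->
  f1 (x :: u) = (f (x :: u) + (-1) ^+ e * (x == j)%:R * f u)%R by exact: coefM_unit_var.
have f10 : f1 [::] = f [::].
  by rewrite /f1 [LHS]coefM0 /letter_eval; case: (e); rewrite [X in X * _]/= mul1r.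
move=> alt fa pos van; have [ej|nj] := eqVneq j l'.2.
  have f1a : f1 a = f a.
    case: a alt {fa pos van} => [//|x a] /= /andP[xj alt]; rewrite fE //.
    by rewrite ej eq_sym (negPf xj) mulr0 mul0r addr0.
  have {red} el : e = l'.1.
    by case: red => /eqP; rewrite ?ej ?eqxx.
  rewrite -el in pos.
  exists a; rewrite f1a ej; split=> // [|x u alt' au].
    rewrite fE // ?ej // eqxx mulr1 mulrDr addr_gt0 // mulrACA -!expr2 sqrr_sign mul1r.
    by rewrite exprn_even_gt0.
  move=> h; rewrite fE // van // add0r ej.
  move: h; have [xl|_] := eqVneq x l'.2; last by rewrite mulr0 mul0r.
  case: u au alt' => [//|y u] /= au /andP[xy alt'] lt.
  by rewrite van ?mulr0 // -xl eq_sym xy.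
(* Here [j] opens a new run, so [l'.2 :: a] takes the place of [a]. *)
have alt1 : sorted (fun x y => x != y) [:: j, l'.2 & a] by rewrite /= nj.
have fla : f (l'.2 :: a) != 0%R by apply: contraTneq pos => ->; rewrite mulr0 ltxx.
have f1la : f1 (l'.2 :: a) = f (l'.2 :: a).
  by rewrite fE // eq_sym (negPf nj) mulr0 mul0r addr0.
have f1j : f1 [:: j, l'.2 & a] = ((-1) ^+ e * f (l'.2 :: a))%R.
  by rewrite fE // eqxx mulr1 (van j) ?nj ?add0r /=.
exists (l'.2 :: a); rewrite f1la f1j; split=> // [|x u alt' au h].
  by rewrite mulrACA -!expr2 sqrr_sign mul1r exprn_even_gt0.
have au' : (size a < size u)%N by exact: au.
rewrite fE // van ?au' ?orbT // ?(ltnW au') // add0r.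
move: h; have [_|_ _] := eqVneq x j; last by rewrite mulr0 mul0r.
case: u {au'} au alt' => [//|y u] /= au /andP[_ alt'] lt.
have lt' : (size a < size u)%N by exact: lt.
by rewrite van ?mulr0 ?lt' ?orbT // ltnW.
Qed.

(** Freeness expressed without a free group: a relation between the 1 + X_j holds in every group.
    Nonempty reduced words are excluded by [reduced_coef]; any other nonempty word shortens by a
    cancellation. *)
Lemma unit_var_free (w : seq (bool * nat)) : word_eval unit_var w = 1 ->
  forall (G : groupType) (h : nat -> G), word_eval h w = 1.
Proof.
have [m] := ubnP (size w); elim: m w => [//|m IH] w; rewrite ltnS => wm e G h.
have [red|/not_sortedP[u [[e1 j1] [[e2 j2] [v [ew]]]]]] := boolP (sorted reduced_rel w).
  case: w red e {wm} => [//|l w] red e; have [a [_ _ pos _]] := reduced_coef red.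
  by move: pos; rewrite e uval1 coef1 mulr0 ltxx.
rewrite /reduced_rel /= negb_or negbK => /andP[/eqP ej ne]; subst j2.
have cancel (H : groupType) (k : nat -> H) : word_eval k w = word_eval k (u ++ v).
  rewrite ew !word_eval_cat /= /letter_eval /=; congr (_ * _); rewrite mulgA.
  by case: e1 e2 ne {ew} => -[] //= _; rewrite ?mulgV ?mulVg mul1g.
rewrite cancel; apply: IH; last by rewrite -cancel.
by move: wm; rewrite ew !size_cat /=; lia.
Qed.

(** * Longitudes of Magnus colours *)

Definition restr (n : nat) (f : series) : series :=
  fun w => if all (gtn n) w then f w else 0%R.

Lemma restrM n f g : restr n (f * g)%R = (restr n f * restr n g)%R.
Proof.
apply/funext => w; elim: w f => [//|a w IH] f.
have -> : restr n (f * g)%R (a :: w) =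
    (if (a < n)%N then f [::] * restr n g (a :: w) + restr n (tails f a * g) w else 0)%R.
  by rewrite /restr /=; case: ltnP => //= _; case: ifP => // _; rewrite mulr0 addr0.
rewrite coefM_cons; have [an|an] := ltnP a n.
  rewrite IH; have -> : restr n (tails f a) = tails (restr n f) a => //.
  by apply/funext => v; rewrite /restr /tails /= an.
have -> : tails (restr n f) a = 0%R by apply/funext => v; rewrite /tails /restr /= ltnNge an.
by rewrite mul0r addr0 [X in (_ * X)%R]/restr /= ltnNge an mulr0.
Qed.

Lemma restr1 n : restr n 1%R = 1%R.
Proof. by apply/funext => -[|a w]; rewrite /restr //=; case: ifP. Qed.

Lemma cong_eq f g : (forall m, cong m f g) -> f = g.
Proof. by move=> h; apply/funext => w; exact: (h (size w).+1). Qed.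

(** Strands of trivial colour do not affect the longitudes of the others, so the strands from [n] on
    are in effect deleted. *)
Definition gen (n j : nat) : units series := if (j < n)%N then unit_var j else 1.

Lemma gen_ge n j : n <= j -> gen n j = 1.
Proof. by rewrite /gen ltnNge => ->. Qed.

Lemma longitude_cong m (phi : series -> series) (col col' : nat -> units series) :
  cong m (phi 1%R) 1%R ->
  (forall f g, cong m (phi (f * g)%R) (phi f * phi g)%R) ->
  (forall i, cong m (phi (uval (col i))) (uval (col' i))) ->
  forall n (b : braid n) k,
    cong m (phi (uval (longitude col b k))) (uval (longitude col' b k)).
Proof.
move=> phi1 phiM hcol n b k.
apply: (@longitude_rel _ _ col col' (fun u v => cong m (phi (uval u)) (uval v))) => //.
- move=> u u' v v' hu hv; rewrite !uvalM; apply: cong_trans (phiM _ _) _.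
  exact: cong_mul.
(* The image under [phi] of the inverse of [u], times [u'], is congruent to [phi] of 1, hence to
   1. *)
- move=> u u' hu; rewrite -[phi _]mulr1 -(uvalKV u') mulrA -[X in cong m _ X]mul1r.
  apply: cong_mul => //; apply: cong_trans (cong_sym _) phi1.
  rewrite -(uvalVK u); apply: cong_trans (phiM _ _) _.
  exact: cong_mul.
Qed.

Lemma restr_gen m n j : m <= n -> restr m (uval (gen n j)) = uval (gen m j).
Proof.
move=> mn; rewrite /gen; have [jm|jm] := ltnP j m.
  rewrite (leq_trans jm mn); apply/funext => w; rewrite /restr.
  case: ifP => // /negbT h; rewrite uval_var coefD coef1 /var; case: w h => [//|a w] h /=.
  by case: eqP h => // -[-> ->] /=; rewrite jm.
case: ifP => _; last exact: restr1.
apply/funext => -[//|a w]; rewrite uval_var /restr coefD /var coef1 /= eqseq_cons add0r.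
case: ltnP => //= am; case: ifP => // _; case: eqP => //= e; lia.
Qed.

Lemma longitude_gen_restr m n n' (b : braid n') k : m <= n ->
  restr m (uval (longitude (gen n) b k)) = uval (longitude (gen m) b k).
Proof.
move=> mn; apply: cong_eq => p; apply: longitude_cong => [|f g|i].
- by rewrite restr1.
- by rewrite restrM.
- by rewrite restr_gen.
Qed.

Lemma longitude_gen_supp n n' (b : braid n') k w :
  ~~ all (gtn n) w -> uval (longitude (gen n) b k) w = 0%R.
Proof. by move=> h; rewrite -(@longitude_gen_restr n n) // /restr (negPf h). Qed.

Lemma unit_const (u : units series) : uval u [::] = 1%R -> uval u^-1 [::] = 1%R.
Proof.
move=> hu; have := congr1 (fun f : series => f [::]) (uvalVK u).
by rewrite /= coefM0 hu mulr1.
Qed.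

Lemma longitude_const (col : nat -> units series) n (b : braid n) k :
  (forall i, uval (col i) [::] = 1%R) -> uval (longitude col b k) [::] = 1%R.
Proof.
move=> hcol.
apply: (@longitude_rel _ _ col col (fun u _ => uval u [::] = 1%R)) => //.
- by move=> u _ v _ hu hv; rewrite uvalM coefM0 hu hv mulr1.
- by move=> u _; exact: unit_const.
Qed.

Lemma gen_const n j : uval (gen n j) [::] = 1%R.
Proof. by rewrite /gen; case: ifP. Qed.

(** The Magnus colours are universal: longitudes in other colours arise by replacing X_j with
    [col j] minus 1. *)
Lemma longitude_subst n m (col : nat -> units series) n' (b : braid n') k :
  (forall j, uval (col j) [::] = 1%R) -> (forall j, n <= j -> col j = 1) ->
  cong m (subst n (fun j => uval (col j) - 1)%R m (uval (longitude (gen n) b k)))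
         (uval (longitude col b k)).
Proof.
move=> col0 col1; set Y := fun j => _.
have Y0 j : Y j [::] = 0%R by rewrite /Y coefD coefN col0 subrr.
apply: longitude_cong => [|f g|j]; first exact: subst1; first exact: substM.
have [jn|jn] := ltnP j n; last by rewrite gen_ge // col1 //; exact: subst1.
rewrite /gen jn uval_var; case: m => [//|m] /=; rewrite coefD mulr1z.
have -> : uval (col j) = (1 + Y j * 1)%R by rewrite mulr1 /Y addrC subrK.
apply: cong_add => //; rewrite (bigD1 (Ordinal jn)) //= big1 ?addr0 => [|i ij].
  apply: (cong_mulY Y0).
  have -> : tails (1 + var j)%R j = 1%R; last exact: subst1.
  by apply/funext => w; rewrite /tails coefD coef1 /var eqseq_cons eqxx add0r.
have -> : tails (1 + var j)%R i = 0%R; last by rewrite subst0 mulr0.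
apply/funext => w; rewrite /tails coefD coef1 /var eqseq_cons add0r.
by case: (eqVneq (i : nat) j) ij => // e; case/eqP; apply: val_inj.
Qed.

(** * Combing *)

Lemma sg_ge n a : n.-1 <= a -> sg n a = 1.
Proof. by rewrite /sg => h; case: insubP => // j; rewrite ltnNge h. Qed.

Lemma incl_step n (u v : bword n) : braid_step u v ->
  word_eval (sg n.+1) (nat_word u) = word_eval (sg n.+1) (nat_word v).
Proof.
case=> [u' v' e j|u' v' j k h|u' v' j k h];
  rewrite /nat_word !map_cat !word_eval_cat /= /letter_eval /= ?mulg1 -?mulgA; congr (_ * _).
- by case: e => /=; rewrite mulgA ?mulgV ?mulVg mul1g.
- by rewrite !mulgA; congr (_ * _); apply: sg_commute; rewrite h.
- rewrite !mulgA; congr (_ * _); rewrite h; apply: sg_braid => /=.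
  by have := ltn_ord k; have := ltn_ord j; lia.
Qed.

Definition incl n (b : braid n) : braid n.+1 :=
  word_eval (sg n.+1) (nat_word (word_of b)).

Lemma incl_of n (w : bword n) : incl (braid_of w) = word_eval (sg n.+1) (nat_word w).
Proof. exact: (braid_lift (@incl_step n)). Qed.

Lemma inclM n (a b : braid n) : incl (a * b) = incl a * incl b.
Proof.
rewrite -[a]word_ofK -[b]word_ofK -braid_piM !incl_of.
by rewrite /nat_word map_cat word_eval_cat.
Qed.

Lemma incl1 n : incl (1 : braid n) = 1.
Proof. exact: (incl_of [::]). Qed.

Lemma inclV n (b : braid n) : incl b^-1 = (incl b)^-1.
Proof. by apply: (mulgI (incl b)); rewrite -inclM !mulgV incl1. Qed.

Lemma incl_sg n a : a < n.-1 -> incl (sg n a) = sg n.+1 a.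
Proof.
move=> h; rewrite -(sgE (Ordinal h)) /sigma incl_of /= mulg1.
by rewrite /letter_eval.
Qed.

Lemma act_letter_sg (G : groupType) (col : nat -> G) n l t : l.2 < n.-1 ->
  act col (letter_eval (sg n) l) t = act_letter col t l.
Proof. by case: l => [[] a] /= h; [exact: act_sgV|exact: act_sg]. Qed.

Lemma act_incl (G : groupType) (col : nat -> G) n (b : braid n) t :
  act col (incl b) t = act col b t.
Proof.
rewrite -[b]word_ofK incl_of act_of.
elim: (word_of b) t => [|[e j] w IH] t; first exact: act1.
by rewrite /= actM act_letter_sg ?IH //=; have := ltn_ord j; lia.
Qed.

Section Combing.
Variable n : nat.
Local Notation s := (sg n.+1).

(** The braid s_(n-1) ... s_k, which moves the last strand over the others to position [k]. *)
Definition sweep (k : nat) : braid n.+1 :=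
  word_eval s [seq (false, i) | i <- rev (iota k (n - k))].

Lemma sweep_n : sweep n = 1.
Proof. by rewrite /sweep subnn. Qed.

Lemma sweepS k : k < n -> sweep k = sweep k.+1 * s k.
Proof.
by move=> h; rewrite /sweep subnS -[in LHS](@prednK (n - k)) ?subn_gt0 //= rev_cons
  map_rcons -cats1 word_eval_cat /= mulg1.
Qed.

Lemma sweep_commute k a : a.+1 < k -> k <= n -> commute (sweep k) (s a).
Proof.
move=> ak kn; have [d ed] : exists d, n - k = d by exists (n - k).
elim: d k ak kn ed => [|d IH] k ak kn ed.
  by rewrite (_ : k = n) ?sweep_n; [exact/commute_sym/commute1|lia].
rewrite sweepS; last by lia.
apply: commute_sym; apply: commuteM; apply: commute_sym; first by apply: IH; lia.
by apply: sg_commute; lia.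
Qed.

(** A crossing of two strands slides below the sweeping strand, which shifts its index by one; the
    braid relation enters at [k = a]. *)
Lemma sweep_shift k a : k <= a -> a.+1 < n -> sweep k * s a.+1 = s a * sweep k.
Proof.
move=> ka an; have [d ed] : exists d, a - k = d by exists (a - k).
elim: d k ka ed => [|d IH] k ka ed.
  have -> : k = a by lia.
  rewrite (@sweepS a) ?(@sweepS a.+1); try lia.
  have c : commute (sweep a.+2) (s a) by apply: sweep_commute.
  rewrite -!mulgA (mulgA (s a.+1)) -sg_braid /=; last by lia.
  by rewrite !mulgA c.
rewrite sweepS; last by lia.
have c : commute (s k) (s a.+1) by apply: sg_commute; lia.
by rewrite -mulgA c !mulgA IH; lia || rewrite -?mulgA.
Qed.

(* The last strand goes over to strand j, loops once around it, and comes back. *)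
Definition loop (j : nat) : braid n.+1 := (s j * s j) ^ (sweep j.+1)^-1.

Lemma loopE j : loop j = sweep j.+1 * (s j * s j) * (sweep j.+1)^-1.
Proof. by rewrite /loop conjgE invgK mulgA. Qed.

Lemma loop_ge j : n <= j -> loop j = 1.
Proof. by move=> h; rewrite /loop sg_ge // mulg1 conj1g. Qed.

Lemma loop_commute j a : j < n -> (a.+1 < j) || (j < a) && (a.+1 < n) ->
  commute (loop j) (s a).
Proof.
move=> jn; rewrite loopE => /orP[aj|/andP[ja an]].
  have c : commute (s a) (sweep j.+1) by apply/commute_sym/sweep_commute; lia.
  have c' : commute (s a) (s j) by apply: sg_commute; lia.
  apply: commute_sym; apply: commuteM; last exact: commuteV.
  by apply: commuteM => //; exact: commuteM.
have sh : sweep j.+1 * s a.+1 = s a * sweep j.+1 by exact: sweep_shift.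
have c : commute (s j) (s a.+1) by apply: sg_commute; lia.
rewrite /commute -mulgA.
have -> : (sweep j.+1)^-1 * s a = s a.+1 * (sweep j.+1)^-1.
  by apply: (mulgI (sweep j.+1)); rewrite !mulgA mulgV mul1g sh mulgK.
by rewrite !mulgA -sh -!mulgA; congr (_ * _); rewrite !mulgA -c -(mulgA _ _ (s j)) -c !mulgA.
Qed.

Lemma loop_conj j : j.+1 < n -> loop j.+1 ^ s j = loop j.
Proof.
move=> jn; rewrite !loopE (@sweepS j.+1) // conjgE.
have c : commute (sweep j.+2) (s j) by apply: sweep_commute.
have b : s j * s j.+1 * s j = s j.+1 * s j * s j.+1 by apply: sg_braid => /=; lia.
move: c b; move: (sweep _) (s j) (s j.+1) => t x y c b.
have c' : t^-1 * x = x * t^-1.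
  by apply: (mulgI t); rewrite !mulgA mulgV mul1g c mulgK.
have e : y * y * x * y = x * y * x * x.
  have b' w : y * (x * (y * w)) = x * (y * (x * w)) by rewrite !mulgA -b.
  have b'' : y * (x * y) = x * (y * x) by rewrite !mulgA -b.
  by rewrite -!mulgA b'' b'.
apply: (mulgI x); rewrite mulKVg invgM !mulgA -c -(mulgA _ t^-1 x) c' !mulgA.
by congr (_ * _); apply: (mulIg y); rewrite mulgVK -!(mulgA t) e.
Qed.

(** The product of two adjacent loops encircles both strands together, so it does not see their
    crossing. *)
Lemma loop_loop_commute j : j.+1 < n -> commute (s j) (loop j * loop j.+1).
Proof.
move=> jn; rewrite !loopE (@sweepS j.+1) //.
have c : commute (sweep j.+2) (s j) by apply: sweep_commute.
have b : s j * s j.+1 * s j = s j.+1 * s j * s j.+1 by apply: sg_braid => /=; lia.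
move: c b; move: (sweep _) (s j) (s j.+1) => t x y c b.
have -> : t * y * (x * x) * (t * y)^-1 * (t * (y * y) * t^-1) =
    t * (y * (x * x) * y) * t^-1.
  by rewrite invgM !mulgA mulgVK mulgVK.
have c2 : commute x (y * (x * x) * y).
  have b' w : y * (x * (y * w)) = x * (y * (x * w)) by rewrite !mulgA -b.
  have b'' : y * (x * y) = x * (y * x) by rewrite !mulgA -b.
  by rewrite /commute -!mulgA -b' -b''.
apply: commuteM; last exact/commuteV/commute_sym.
by apply: commuteM => //; exact: commute_sym.
Qed.

Definition in_loops (b : braid n.+1) : Prop := exists w, b = word_eval loop w.

Lemma in_loops1 : in_loops 1.
Proof. by exists [::]. Qed.

Lemma in_loopsM a b : in_loops a -> in_loops b -> in_loops (a * b).
Proof. by move=> [u ->] [v ->]; exists (u ++ v); rewrite word_eval_cat. Qed.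

Lemma in_loops_loop j : in_loops (loop j).
Proof. by exists [:: (false, j)]; rewrite /= mulg1. Qed.

Lemma in_loopsV a : in_loops a -> in_loops a^-1.
Proof.
move=> [w ->]; elim: w => [|[e j] w IH] /=; first by rewrite invg1; exact: in_loops1.
rewrite invgM; apply: in_loopsM => //.
by exists [:: (~~ e, j)]; rewrite /letter_eval /= mulg1; case: e; rewrite ?invgK.
Qed.

(** These are Artin's automorphisms: conjugation by [s a] fixes [loop a * loop a.+1] and the other
    loops, and sends [loop a.+1] to [loop a]; the remaining images are solved from this. *)
Lemma in_loops_conj_sg a j (e : bool) : a < n.-1 ->
  in_loops (loop j ^ (if e then (s a)^-1 else s a)).
Proof.
move=> an; have [jn|jn] := ltnP j n; last by rewrite loop_ge // conj1g; exact: in_loops1.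
have [h|h] := boolP ((a.+1 < j) || (j < a)).
  have c : commute (loop j) (s a) by apply: loop_commute => //; lia.
  have -> : loop j ^ (if e then (s a)^-1 else s a) = loop j; last exact: in_loops_loop.
  by apply/conjg_fixP/commgP; case: e => //; exact: commuteV.
have ja : (j == a) || (j == a.+1) by lia.
have an' : a.+1 < n by lia.
have xy := loop_conj an'; have c := loop_loop_commute an'.
have hx := in_loops_loop a; have hy := in_loops_loop a.+1.
case/orP: ja => /eqP ->; case: e.
- by rewrite -xy conjgK.
- have -> : loop a ^ s a = loop a * loop a.+1 * (loop a)^-1.
    apply: (mulIg (loop a)); rewrite mulgVK -{2}xy -conjMg.
    exact/conjg_fixP/commgP/commute_sym.
  by apply: in_loopsM; [exact: in_loopsM|exact: in_loopsV].
- have -> : loop a.+1 ^ (s a)^-1 = (loop a.+1)^-1 * loop a * loop a.+1.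
    apply: (mulgI (loop a.+1)); rewrite -[X in _ = _ * X]mulgA mulKVg.
    have {1}-> : loop a.+1 = loop a ^ (s a)^-1 by rewrite -xy conjgK.
    by rewrite -conjMg; apply/conjg_fixP/commgP/commuteV/commute_sym.
  by apply: in_loopsM => //; apply: in_loopsM => //; exact: in_loopsV.
- by rewrite xy.
Qed.

Lemma in_loops_conj (b : braid n) x : in_loops x -> in_loops (x ^ incl b).
Proof.
have conj_word c y : (forall j, in_loops (loop j ^ c)) -> in_loops y -> in_loops (y ^ c).
  move=> h [w ->]; elim: w => [|[e j] w IH] /=; first by rewrite conj1g; exact: in_loops1.
  rewrite conjMg; apply: in_loopsM => //; rewrite /letter_eval /=; case: e => //.
  by rewrite conjVg; exact: in_loopsV.
move=> hx; rewrite -[b]word_ofK incl_of.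
elim: (word_of b) x hx => [|[e j] w IH] x hx; first by rewrite conjg1.
rewrite /= conjgM; apply: IH; move: hx; apply: conj_word => k.
exact: (in_loops_conj_sg k e (ltn_ord j)).
Qed.

(** Products of this form are stable under right multiplication by a letter, because conjugation by
    [incl c] preserves words in the loops. *)
Lemma combing (b : braid n.+1) : exists w c k,
  k <= n /\ b = word_eval loop w * incl c * sweep k.
Proof.
suff comb (w : bword n.+1) : exists u c k,
    [/\ in_loops u, k <= n & braid_of w = u * incl c * sweep k].
  have [_ [c [k [[w ->] kn e]]]] := comb (word_of b).
  by exists w, c, k; rewrite -[b]word_ofK.
elim/last_ind: w => [|w [e j] [u [c [k [hu kn IH]]]]].
  exists 1, 1, n; rewrite incl1 sweep_n !mulg1; split=> //; exact: in_loops1.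
have jn : j < n by have := ltn_ord j; lia.
rewrite -cats1 braid_piM IH braid_pi_letter sgE -mulgA.

suff [v [d [k' [hv k'n ->]]]] : exists v d k', [/\ in_loops v, k' <= n &
    sweep k * (if e then (s j)^-1 else s j) = v * incl d * sweep k'].
  exists (u * v ^ incl c^-1), (c * d), k'; split=> //.
    by apply: in_loopsM => //; exact: in_loops_conj.
  by rewrite inclM inclV conjgE invgK !mulgA mulgVK.
(* For [k < j] the letter slides through the sweep, and for [k > j.+1] it commutes with it. For
   [k = j] or [k = j.+1] it shortens or lengthens the sweep, sometimes at the cost of a loop. *)
have [kj|jk|kj] := ltngtP k j.
- exists 1, (if e then (sg n j.-1)^-1 else sg n j.-1), k; split=> //; first exact: in_loops1.
  have h : sweep k * s j = s j.-1 * sweep k.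
    by case: (nat_of_ord j) kj jn => // a ka an; exact: sweep_shift.
  rewrite mul1g; case: e; last by rewrite h incl_sg //; lia.
  rewrite inclV incl_sg; last by lia.
  by apply: (mulIg (s j)); rewrite mulgVK -mulgA h mulKg.
- have [ejk|njk] := eqVneq k j.+1.
    rewrite ejk; case: e; last first.
      by exists 1, 1, j; rewrite incl1 !mul1g (sweepS jn); split=> //;
        [exact: in_loops1|exact: ltnW].
    exists (loop j)^-1, 1, j; split; [exact/in_loopsV/in_loops_loop|exact: ltnW|].
    rewrite incl1 mulg1 (sweepS jn) loopE !invgM invgK !mulgA mulgVK.
    by rewrite mulgVK.
  have h : commute (sweep k) (s j) by apply: sweep_commute; lia.
  exists 1, (if e then (sg n j)^-1 else sg n j), k; split=> //; first exact: in_loops1.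
  rewrite mul1g; case: e; rewrite ?inclV incl_sg; try lia; last exact: h.
  exact/commuteV.
- rewrite -kj in jn *; case: e.
    exists 1, 1, k.+1; rewrite incl1 !mul1g (sweepS jn) mulgK; split=> //; exact: in_loops1.
  exists (loop k), 1, k.+1; split; [exact: in_loops_loop|by []|].
  by rewrite incl1 mulg1 loopE mulgVK (sweepS jn) -mulgA.
Qed.

End Combing.

(** * The last strand when its colour is trivial *)

Section LastStrand.
Variables (G : groupType) (col : nat -> G) (n : nat).

Lemma pass_under_trivial e p q : carried col q = 1 -> pass_under col e p q = p.
Proof. by rewrite /pass_under => ->; rewrite invg1 mulg1 if_same -surjective_pairing. Qed.

Lemma act_sweep k t : carried col (t n) = 1 -> k <= n ->
  act col (sweep n k) t = fun i =>
    if i < k then t i else if i == k then t n else if i <= n then t i.-1 else t i.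
Proof.
move=> tn1 kn; have [d ed] : exists d, n - k = d by exists (n - k).
elim: d k kn ed => [|d IH] k kn ed; apply/funext => i.
  rewrite (_ : k = n) ?sweep_n ?act1; last by lia.
  by split_ifs => //; congr t; lia.
have kn' : k < n by lia.
rewrite sweepS // actM act_sg // IH //; last by lia.
rewrite /act_letter /=; split_ifs => //; rewrite ?pass_under_trivial //; try (by congr t; lia).
Qed.

Definition set_last (t : nat -> nat * G) (g : G) (i : nat) : nat * G :=
  if i == n then (n, g) else t i.

Hypothesis coln : col n = 1.

Let carried_last g : carried col (n, g) = 1.
Proof. by rewrite /carried coln conj1g. Qed.

(** On the way to strand [j] and back the last strand is on top, where its trivial colour has no
    effect; it passes under strand [j] once and picks up what that strand carries. *)
Lemma act_loop j t g : j < n ->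
  act col (loop n j) (set_last t g) = set_last t (g * carried col (t j)).
Proof.
move=> jn; rewrite loopE actM.
suff -> : act col (sweep n j.+1 * (sg n.+1 j * sg n.+1 j)) (set_last t g) =
    act col (sweep n j.+1) (set_last t (g * carried col (t j))) by rewrite -actM mulgV act1.
have tn1 h : carried col (set_last t h n) = 1 by rewrite /set_last eqxx carried_last.
rewrite !actM !act_sweep // !act_sg //; apply/funext => i; rewrite /act_letter /= /set_last.
split_ifs => //; rewrite ?(pass_under_trivial _ _ (carried_last g)) //.
by congr t; lia.
Qed.

Lemma act_loops (w : seq (bool * nat)) t g :
  (forall j, n <= j -> carried col (t j) = 1) ->
  act col (word_eval (loop n) w) (set_last t g) =
  set_last t (g * word_eval (fun j => carried col (t j)) w).
Proof.
move=> tn; have loopK j h : act col (loop n j) (set_last t h) = set_last t (h * carried col (t j)).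
  have [jn|jn] := ltnP j n; first exact: act_loop.
  by rewrite loop_ge // act1 tn // mulg1.
elim: w g => [|[e j] w IH] g /=; first by rewrite act1 mulg1.
rewrite actM mulgA -IH; congr (act _ _ _); case: e; rewrite /letter_eval /=; last exact: loopK.
have -> : set_last t g = act col (loop n j) (set_last t (g * (carried col (t j))^-1)).
  by rewrite loopK mulgVK.
by rewrite -actM mulgV act1.
Qed.

Lemma set_last_id t : t n = (n, 1) -> set_last t 1 = t.
Proof. by move=> h; apply/funext => i; rewrite /set_last; case: eqP => // ->. Qed.

End LastStrand.

Lemma longitude_gen_faithful n (b : braid n) : pure b ->
  (forall k, longitude (gen n) b k = 1) -> b = 1.
Proof.
elim: n b => [|n IH] b pb hb.
  by rewrite -[b]word_ofK; case: (word_of b) => [//|[e []]].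
(* Setting X_n = 0 makes the colour of the last strand trivial. *)
have hb' k : longitude (gen n) b k = 1.
  by apply: uval_inj; rewrite -(longitude_gen_restr b k (leqnSn n)) hb; exact: restr1.
set t0 := fun i : nat => (i, 1 : units series).
have coln : gen n n = 1 by rewrite gen_ge.
have carried0 j : carried (gen n) (t0 j) = gen n j by rewrite /carried conjg1.
have bt0 : act (gen n) b t0 = t0.
  by apply/funext => k; rewrite act_pure // hb'.
have [w [c [k [kn eb]]]] := combing b.
set x := word_eval (gen n) w.
have act_u : act (gen n) (word_eval (loop n) w) t0 = set_last n t0 x.
  rewrite -{1}(@set_last_id _ n t0) // act_loops // ?mul1g.
    by congr (set_last _ _ (word_eval _ _)); apply/funext => j; exact: carried0.
  by move=> j nj; rewrite carried0 gen_ge.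
set t1 := act (gen n) c (set_last n t0 x).
have t1n : t1 n = (n, x) by rewrite /t1 act_above // /set_last eqxx.
have e1 : act (gen n) (sweep n k) t1 = t0.
  by rewrite -[RHS]bt0 eb !actM act_u act_incl.
(* The sweep brings the last strand, of label [n], to position [k], where [e1] requires the label
   [k]. *)
have ekn : k = n.
  have := congr1 (@^~ k) e1; rewrite act_sweep //; last by rewrite t1n /carried coln conj1g.
  by rewrite ltnn eqxx t1n => -[].
move: eb e1; rewrite ekn sweep_n mulg1 act1 => eb e1.
have x1 : x = 1 by have := congr1 (@^~ n) e1; rewrite t1n => -[].
(* The last longitude [x] spells [w], so freeness makes [w] trivial on the loops too. Letters of
   index at least [n] are dropped first, since [gen n] agrees with [unit_var] below [n] only. *)
have w1 : word_eval (loop n) w = 1.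
  have filterE (G : groupType) (h : nat -> G) : (forall j, n <= j -> h j = 1) ->
    word_eval h w = word_eval h [seq l <- w | l.2 < n].
    move=> h1; elim: (w) => [//|[e j] v IHv] /=; rewrite IHv; case: ltnP => //= nj.
    by rewrite /letter_eval /= h1 // invg1 if_same mul1g.
  rewrite filterE; last exact: loop_ge.
  apply: unit_var_free; rewrite -x1 /x filterE; last exact: gen_ge.
  elim: (w) => [//|[e j] v IHv] /=; case: ifP => //= jn; rewrite IHv.
  by rewrite /letter_eval /= /gen jn.
rewrite eb w1 mul1g in pb hb bt0 *; rewrite act_incl in bt0.
rewrite (IH c) ?incl1 //.
  apply/eqP/permP => i; rewrite perm1; apply: val_inj.
  by have := act_label (gen n) c t0 i; rewrite bt0.
by move=> i; rewrite /longitude bt0.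
Qed.

(** * The order on pure braids *)

Definition key (i : nat) (w : seq nat) : seq nat := [:: size w, i & w].

Definition positive (F : nat -> series) : Prop := exists i w,
  (0 < F i w)%R /\ forall j v, lexlt (key j v) (key i w) -> F j v = 0%R.

Lemma positive0 : ~ positive (fun=> 0%R).
Proof. by move=> [i [w []]]; rewrite ltxx. Qed.

Lemma key_inj i w j v : key i w = key j v -> i = j /\ w = v.
Proof. by case. Qed.

Lemma positiveD F F' : positive F -> positive F' -> positive (fun i => F i + F' i)%R.
Proof.
move=> [i [w [p h]]] [i' [w' [p' h']]].
have [lt|/orP[/eqP/key_inj[ei ew]|lt]] := orP (lexlt_total (key i w) (key i' w')).
- exists i, w; split=> [|j v lt']; first by rewrite coefD (h' _ _ lt) addr0.
  by rewrite coefD h // h' ?addr0 //; exact: lexlt_trans lt.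
- exists i, w; split=> [|j v lt']; first by rewrite coefD addr_gt0 // ei ew.
  by rewrite coefD h // h' ?addr0 // -ei -ew.
- exists i', w'; split=> [|j v lt']; first by rewrite coefD (h _ _ lt) add0r.
  by rewrite coefD h' // h ?addr0 //; exact: lexlt_trans lt.
Qed.

(** The lexicographic order is well founded on words of a given length, but not on all words; this
    is why [key] begins with the degree. *)
Lemma lex_min m (Q : seq nat -> Prop) : (exists2 w, size w = m & Q w) ->
  exists w, [/\ size w = m, Q w & forall v, size v = m -> lexlt v w -> ~ Q v].
Proof.
elim: m Q => [|m IH] Q [w sw Qw].
  by exists w; split=> // v _; rewrite (size0nil sw) lexlt_nil.
pose P a := `[< exists2 v, size v = m & Q (a :: v) >].
have exP : exists a, P a.
  by case: w sw Qw => [//|a v] [sv] Qv; exists a; apply/asboolP; exists v.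
case: (ex_minnP exP) => a /asboolP/(IH (fun v => Q (a :: v)))[v [sv Qv minv]] mina.
exists (a :: v); split=> //=; first by rewrite sv.
case=> [//|b u] [su]; rewrite lexlt_cons => /orP[ba|/andP[/eqP -> uv]] Qu.
  by have /mina : P b by [apply/asboolP; exists u]; rewrite leqNgt ba.
exact: minv uv Qu.
Qed.

Lemma positive_total F : (exists i, F i <> 0%R) -> positive F \/ positive (fun i => - F i)%R.
Proof.
move=> [i0 Fi0]; pose P m := `[< exists i w, size w = m /\ F i w <> 0%R >].
have exP : exists m, P m.
  have [w hw] : exists w, F i0 w <> 0%R.
    apply: contrapT => h; apply: Fi0; apply/funext => w.
    by apply: contrapT => h'; apply: h; exists w.
  by exists (size w); apply/asboolP; exists i0, w.
case: (ex_minnP exP) => m /asboolP[i1 [w1 [sw1 h1]]] minm.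
(* Strand and monomial are minimized together, as one word of length [m.+1]. *)
pose Q s := if s is i :: w then F i w <> 0%R else False.
have [|[|i w] [] // [sw] Fw minw] := @lex_min m.+1 Q.
  by exists (i1 :: w1); rewrite //= sw1.
have zero j v : lexlt (key j v) (key i w) -> F j v = 0%R.
  rewrite lexlt_cons sw => /orP[lt|/andP[/eqP sv lt]]; apply: contrapT => h.
    by have /minm : P (size v) by [apply/asboolP; exists j, v]; rewrite leqNgt lt.
  by apply: (minw (j :: v)) => //=; rewrite sv.
have [lt|gt|e] := ltgtP (F i w) 0%R; last by case: Fw.
  by right; exists i, w; split=> [|j v /zero]; rewrite coefN ?oppr_gt0 // => ->; rewrite oppr0.
by left; exists i, w.
Qed.

(** The hypotheses make [e k] the least letter that [c] sends to [k], so [map e w] is the least word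
    over [w]. *)
Lemma lexlt_collapse (c e : nat -> nat) (v w : seq nat) :
  (forall k, c (e k) = k) -> (forall j k, j < e k -> c j < k) ->
  lexlt v (map e w) -> lexlt (map c v) w.
Proof.
move=> ce lt_ce; elim: v w => [|x v IH] [|y w] /=; rewrite ?lexlt_nil //.
rewrite !lexlt_cons => /orP[/lt_ce -> //|/andP[/eqP -> /IH ->]].
by rewrite ce eqxx orbT.
Qed.

(** The leading term of [F] at strand [i] and monomial [w] becomes that of [F'] at [e i] and
    [map e w], with the same coefficient. *)
Lemma positive_collapse (c e : nat -> nat) F F' :
  (forall k, c (e k) = k) -> (forall j k, j < e k -> c j < k) ->
  (forall m, (forall j, cong m (F j) 0%R) ->
     forall j v, size v <= m -> F' j v = F (c j) (map c v)) ->
  positive F -> positive F'.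
Proof.
move=> ce lt_ce hF [i [w [p h]]].
have van j : cong (size w) (F j) 0%R by move=> v lt; apply: h; rewrite lexlt_cons lt.
have {van}hF := hF _ van.
exists (e i), (map e w); split.
  by rewrite hF ?size_map // ce -map_comp (eq_map ce) map_id.
move=> j v; rewrite /key lexlt_cons size_map => /orP[lt|/andP[/eqP sv lt]].
  by rewrite hF ?(ltnW lt) // h // lexlt_cons size_map lt.
rewrite hF ?sv // h // /key lexlt_cons size_map sv eqxx ltnn.
exact: (@lexlt_collapse c e (j :: v) (i :: w)).
Qed.

Lemma positive_perturb F F' :
  (forall m, (forall j, cong m (F j) 0%R) -> forall j v, size v <= m -> F' j v = F j v) ->
  positive F -> positive F'.
Proof.
move=> h; apply: (@positive_collapse id id) => // m hF j v sv.
by rewrite map_id; exact: h hF _ _ sv.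
Qed.

Definition pexp n (b : braid n) (k : nat) : series := uval (longitude (gen n) b k).

Definition plt n (a b : braid n) : Prop := positive (fun k => pexp b k - pexp a k)%R.

Lemma pexp_const n (b : braid n) k : pexp b k [::] = 1%R.
Proof. by apply: longitude_const => j; exact: gen_const. Qed.

Lemma pureM n (a b : braid n) : pure a -> pure b -> pure (a * b).
Proof. by rewrite /pure rhoM => /eqP -> /eqP ->; rewrite mulg1. Qed.

Lemma pureV n (a : braid n) : pure a -> pure a^-1.
Proof. by rewrite /pure rhoV invg_eq1. Qed.

(** By the cocycle rule the longitudes of [a * b^-1] depend on [a] through its longitudes alone, so
    they equal those of [b * b^-1]. *)
Lemma pexp_inj n (a b : braid n) : pure a -> pure b -> pexp a = pexp b -> a = b.
Proof.
move=> pa pb e; have eab : longitude (gen n) a = longitude (gen n) b.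
  by apply/funext => k; apply: uval_inj; exact: (congr1 (@^~ k) e).
have pV := pureV pb.
apply: (mulIg b^-1); rewrite mulgV; apply: longitude_gen_faithful => [|k].
  exact: pureM.
by rewrite longitudeM // eab -longitudeM // mulgV longitude1.
Qed.

Lemma plt_irr n (a : braid n) : ~ plt a a.
Proof.
rewrite /plt (_ : (fun k => _) = fun=> 0%R); first exact: positive0.
by apply/funext => k; rewrite subrr.
Qed.

Lemma plt_trans n (b a c : braid n) : plt a b -> plt b c -> plt a c.
Proof.
move=> h1 h2; have := positiveD h2 h1; rewrite /plt; congr positive.
by apply/funext => k; rewrite addrA subrK.
Qed.

Lemma plt_total n (a b : braid n) : pure a -> pure b -> a <> b -> plt a b \/ plt b a.
Proof.
move=> pa pb ab; have [|h|h] := @positive_total (fun k => pexp b k - pexp a k)%R.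
- apply: contrapT => h; apply: ab; apply: pexp_inj => //; apply/funext => k.
  apply: contrapT => hk; apply: h; exists k => /eqP; rewrite subr_eq0 => /eqP e.
  by apply: hk; rewrite e.
- by left.
- right; move: h; rewrite /plt; congr positive; apply/funext => k; exact: opprB.
Qed.

(* The leading terms only see the linear parts of the colours: here X_j becomes the
   sum of the X_x with [c x = j]. *)
Lemma longitude_lead n (a b : braid n) (col : nat -> units series) (c : nat -> nat) k m v :
  (forall j, uval (col j) [::] = 1%R) -> (forall j, n <= j -> col j = 1) ->
  (forall j x, j < n -> uval (col j) [:: x] = (c x == j)%:R%R) ->
  cong m (pexp b k - pexp a k)%R 0%R -> size v <= m ->
  (uval (longitude col b k) - uval (longitude col a k))%R v =
  (pexp b k - pexp a k)%R (map c v).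
Proof.
move=> col0 col1 colX van vm.
have sub d := @longitude_subst n (size v).+1 col n d k col0 col1.
rewrite [LHS]coefD [X in (_ + X)%R]coefN -!sub // -coefN -coefD -substN -substD.
rewrite (subst_lead _ (c := c)) //.
- by move=> j; rewrite coefD coefN col0 subrr.
- by move=> j x jn; rewrite coefD coefN colX // subr0.
- by move=> w hw; rewrite coefD coefN /pexp !longitude_gen_supp // subrr.
- exact: cong_le van.
Qed.

(** * Invariance under multiplication and splitting *)

Lemma coefM_const1 (f g : series) w : f [::] = 1%R -> cong (size w) g 0%R -> (f * g)%R w = g w.
Proof. by move=> f1 h; rewrite coefM_leadr // f1 mul1r. Qed.

Lemma coefM_1const (f g : series) w : g [::] = 1%R -> cong (size w) f 0%R -> (f * g)%R w = f w.
Proof. by move=> g1 h; rewrite coefM_leadl // g1 mulr1. Qed.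

(** This form shows that conjugation by [g] of constant term 1 keeps the lowest-degree part of
    [u - 1]. *)
Lemma uvalJ (u g : units series) : uval (u ^ g) = (1 + uval g^-1%g * ((uval u - 1) * uval g))%R.
Proof.
by rewrite conjgE !uvalM mulrBl mulrBr mul1r uvalVK addrC subrK.
Qed.

Lemma gen_conj n j (g : units series) x : uval g [::] = 1%R -> j < n ->
  uval (gen n j ^ g) [:: x] = (x == j)%:R%R.
Proof.
move=> g1 jn; have var1 : cong 1 (var j) 0%R by case.
rewrite uvalJ /gen jn uval_var (_ : 1 + var j - 1 = var j)%R; last by rewrite addrC addKr.
rewrite coefD coef1 add0r.
rewrite coefM_const1 ?unit_const //; last first.
  by case=> // _; rewrite coefM0 mul0r.
by rewrite coefM_1const // /var eqseq_cons andbT.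
Qed.

(** The difference of longitudes is taken in colours conjugated by the longitudes of [c] and
    multiplied on the left by one of them; neither change affects its lowest degree. *)
Lemma plt_mull n (c a b : braid n) : pure a -> pure b -> pure c ->
  plt a b -> plt (c * a) (c * b).
Proof.
move=> pa pb pc; apply: positive_perturb => m van k v vm.
rewrite /pexp !longitudeM // !uvalM -mulrBr.
set col := fun i => gen n i ^ _.
have col0 j : uval (col j) [::] = 1%R.
  by rewrite uvalJ coefD !coefM0 coefD coefN gen_const subrr mul0r mulr0 addr0.
have col1 j : n <= j -> col j = 1 by move=> nj; rewrite /col gen_ge // conj1g.
have lead w : size w <= m -> (uval (longitude col b k) - uval (longitude col a k))%R w =
    (pexp b k - pexp a k)%R w.
  move=> wm; rewrite (longitude_lead col0 col1 (c := id) _ (van k) wm) ?map_id //.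
  by move=> j x jn; apply: gen_conj => //; exact: pexp_const.
rewrite coefM_const1 ?lead //; first exact: pexp_const.
by move=> w wv; rewrite lead ?van //; lia.
Qed.

Lemma cong_mull m (f f' g : series) : cong m f f' -> g [::] = 0%R -> cong m.+1 (f * g)%R (f' * g)%R.
Proof.
move=> h g0 w wm; apply: (addIr (- (f' * g)%R w)%R); rewrite subrr.
have -> : ((f * g)%R w - (f' * g)%R w)%R = ((f - f') * g)%R w by rewrite mulrBl.
rewrite coefM_leadl ?g0 ?mulr0 // => v vw; rewrite coefD coefN h ?subrr //; lia.
Qed.

Lemma cong_mulr m (f g g' : series) : cong m g g' -> f [::] = 0%R -> cong m.+1 (f * g)%R (f * g')%R.
Proof.
move=> h f0; exact: (@cong_mulY (fun=> f) (fun=> f0) m 0).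
Qed.

Lemma cong_uvalV m (u v : units series) : cong m (uval u) (uval v) ->
  cong m (uval u^-1) (uval v^-1).
Proof.
move=> h; rewrite -[uval u^-1]mulr1 -(uvalKV v) mulrA -[X in cong m _ X]mul1r.
by apply: cong_mul => //; rewrite -(uvalVK u); apply: cong_mul => //; exact: cong_sym.
Qed.

(** If the longitudes of [a] and [b] agree below degree [m], the colours they conjugate agree below
    [m.+1]. Hence the right factors coming from [c] agree through degree [m], and their constant
    term is 1. *)
Lemma plt_mulr n (c a b : braid n) : pure a -> pure b -> pure c ->
  plt a b -> plt (a * c) (b * c).
Proof.
move=> pa pb pc; apply: positive_perturb => m van k v vm.
have ab j : cong m (pexp b j) (pexp a j).
  by move=> w wm; apply: (addIr (- pexp a j w)%R); rewrite subrr; exact: (van j w wm).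
have colour j : cong m.+1 (uval (gen n j ^ longitude (gen n) b j))
                         (uval (gen n j ^ longitude (gen n) a j)).
  have g0 : (uval (gen n j) - 1)%R [::] = 0%R by rewrite coefD coefN gen_const subrr.
  rewrite !uvalJ; apply: cong_add => //.
  apply: (@cong_trans _ _ (uval (longitude (gen n) b j)^-1%g *
      ((uval (gen n j) - 1) * uval (longitude (gen n) a j)))%R).
    by apply: cong_mul => //; apply: cong_mulr => //; exact: ab.
  by apply: cong_mull; [exact/cong_uvalV/ab|rewrite coefM0 g0 mul0r].
rewrite /pexp !longitudeM // !uvalM; move: (van k) => vank.
set hb := longitude _ c k; set ha := longitude _ c k.
have hba : cong m.+1 (uval hb) (uval ha) by apply: (longitude_cong (phi := id)).
have ha1 : uval ha [::] = 1%R.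
  apply: longitude_const => j.
  by rewrite uvalJ coefD !coefM0 coefD coefN gen_const subrr mul0r mulr0 addr0.
transitivity (((uval (longitude (gen n) b k) - uval (longitude (gen n) a k)) * uval ha)%R v).
  rewrite mulrBl !coefD; congr (_ + _)%R.
  by apply: (cong_mul (cong_refl _) hba); lia.
by rewrite coefM_1const //; exact: cong_le vank.
Qed.

Lemma plt_split n (a b : braid n) (i : 'I_n) : pure a -> pure b ->
  plt a b -> plt (strand_split a i) (strand_split b i).
Proof.
(* The map [c] identifies the two copies [i] and [i.+1] of the doubled strand, and [e] selects the
   first copy. *)
move=> pa pb; pose c j := if j <= i then j else j.-1.
pose e j := if j <= i then j else j.+1.
apply: (@positive_collapse c e) => [j|j k|m van k v vm].
- by rewrite /c /e; split_ifs.
- by rewrite /c /e; split_ifs; lia.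
rewrite /pexp !longitude_split //; set col := fun j => _.
have ni := ltn_ord i.
apply: longitude_lead (van _) vm => [j|j nj|j x jn]; rewrite /col /gen.
- by split_ifs => //; rewrite ?uvalM ?coefM0 ?mul1r ?mulr1.
- by split_ifs.
- have coefX l : (1 + var l)%R [:: x] = (x == l)%:R%R.
    by rewrite coefD coef1 add0r /var eqseq_cons andbT.
  rewrite /c; split_ifs; rewrite ?uvalM ?coefM_cons ?coefM0 !uval_var ?mul1r ?mulr1
    -1?[tails _ x [::]]/((1 + var i)%R [:: x]) ?coefX -?natrD; congr (GRing.natmul 1%R _); lia.
Qed.

(** * The order on BF *)

Definition leaf_depths n (T : tree_of n) : seq nat := depths 0 (val T).

Lemma size_leaf_depths n (T : tree_of n) : size (leaf_depths T) = n.
Proof. by rewrite size_depths (eqP (valP T)). Qed.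

Lemma leaf_depths_inj n : injective (@leaf_depths n).
Proof. by move=> T U /depths_inj e; exact: val_inj. Qed.

Lemma leaf_depths_caret n (T : tree_of n) i :
  leaf_depths (caret T i) = bump_at S i (leaf_depths T).
Proof. by rewrite /leaf_depths /= depths_attach // (eqP (valP T)). Qed.

Inductive triple_lt : triple -> triple -> Prop :=
| TripleLt n (T U V : tree_of n) (p q : braid n) : pure p -> pure q ->
    lexlt (leaf_depths U) (leaf_depths V) \/ U = V /\ plt p q ->
    triple_lt (Triple T p U) (Triple T q V).

Lemma triple_inj n (T T' U U' : tree_of n) (b b' : braid n) :
  Triple T b U = Triple T' b' U' -> [/\ T = T', b = b' & U = U'].
Proof.
by case=> e1 e2 e3; rewrite (existT_nat_inj e1) (existT_nat_inj e2) (existT_nat_inj e3).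
Qed.

Lemma triple_lt_neq x y : triple_lt x y -> x <> y.
Proof.
case=> n T U V p q _ _ h /triple_inj[_ epq eUV]; move: h; rewrite epq eUV lexlt_irr.
by case=> // -[_]; exact: plt_irr.
Qed.

Lemma triple_lt_trans y x z : triple_lt x y -> triple_lt y z -> triple_lt x z.
Proof.
case=> n T U V p q pp pq h; move ey: (Triple T q V) => y' h'.
case: h' ey => m T' U' V' p' q' _ pq' h' ey.
have e := congr1 strands ey; rewrite /= in e; subst m.
have [eT eb eU] := triple_inj ey; subst T' p' U'; apply: TripleLt => //.
case: h h' => [lt1|[-> lt1]] [lt2|[<- lt2]].
- by left; exact: lexlt_trans lt2.
- by left.
- by left.
- by right; split=> //; exact: plt_trans lt2.
Qed.

(** As both braids are pure, the caret lands on leaf [i] of [U] and of [V]. *)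
Lemma triple_lt_expand n (T U V : tree_of n) (p q : braid n) (i : 'I_n) :
  pure p -> pure q -> lexlt (leaf_depths U) (leaf_depths V) \/ U = V /\ plt p q ->
  triple_lt (@expand_at (Triple T p U) i) (@expand_at (Triple T q V) i).
Proof.
move=> pp pq h.
have psp : pure (strand_split p i) by exact: (pure_reach (reach1 (Expand T U p i)) pp).
have psq : pure (strand_split q i) by exact: (pure_reach (reach1 (Expand T V q i)) pq).
rewrite /expand_at /=; have /eqP rp := pp; have /eqP rq := pq.
rewrite rp rq !perm1; apply: TripleLt => //.
case: h => [lt|[-> lt]]; last by right; split=> //; exact: plt_split.
by left; rewrite !leaf_depths_caret; apply: lexlt_bump => //; rewrite !size_leaf_depths.
Qed.

Lemma triple_lt_stepl x y x' : triple_lt x y -> expand x x' ->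
  exists2 y', expand y y' & triple_lt x' y'.
Proof.
move=> h /expandP[i ->]; case: h i => n T U V p q pp pq h i.
exists (@expand_at (Triple T q V) i); first by apply/expandP; exists i.
exact: triple_lt_expand.
Qed.

Lemma triple_lt_stepr x y y' : triple_lt x y -> expand y y' ->
  exists2 x', expand x x' & triple_lt x' y'.
Proof.
move=> h /expandP[i ->]; case: h i => n T U V p q pp pq h i.
exists (@expand_at (Triple T p U) i); first by apply/expandP; exists i.
exact: triple_lt_expand.
Qed.

Lemma triple_lt_reachl x y x' : triple_lt x y -> reach x x' ->
  exists2 y', reach y y' & triple_lt x' y'.
Proof.
move=> h hx; elim: hx y h => [{}x y h|{}x x1 {}x' hx _ IH y h].
  by exists y => //; exact: Reach0.
have [y1 yy1 /IH[y' y1y' h']] := triple_lt_stepl h hx.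
by exists y' => //; exact: ReachS yy1 y1y'.
Qed.

Lemma triple_lt_reachr x y y' : triple_lt x y -> reach y y' ->
  exists2 x', reach x x' & triple_lt x' y'.
Proof.
move=> h hy; elim: hy x h => [{}y x h|{}y y1 {}y' hy _ IH x h].
  by exists x => //; exact: Reach0.
have [x1 xx1 /IH[x' x1x' h']] := triple_lt_stepr h hy.
by exists x' => //; exact: ReachS xx1 x1x'.
Qed.

Lemma reach_dom_inj x y z : reach x y -> reach x z ->
  val (tdom y) = val (tdom z) -> y = z.
Proof.
move=> xy xz e; apply: (can_inj tinvK); apply: (@reach_cod_inj (tinv x)) => //;
  exact: reach_tinv.
Qed.

Lemma triple_lt_dom x y : triple_lt x y -> val (tdom x) = val (tdom y).
Proof. by case. Qed.

(** A common expansion [z] of [x] and [y] would be below an expansion [w] of [y] with the same first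
    tree, but the first tree determines an expansion of [y]. *)
Lemma triple_lt_class x y : triple_lt x y -> bv_of x <> bv_of y.
Proof.
move=> h /bv_of_reach[z xz yz]; have [w yw zw] := triple_lt_reachl h xz.
by apply: (triple_lt_neq zw); exact: reach_dom_inj yz yw (triple_lt_dom zw).
Qed.

Lemma triple_total x y : val (tdom x) = val (tdom y) -> pure (tbraid x) ->
  pure (tbraid y) -> x <> y -> triple_lt x y \/ triple_lt y x.
Proof.
case: x y => [n T p U] [m T' q V] /= e pp pq neq.
have nm : n = m by rewrite -(eqP (valP T)) -(eqP (valP T')) /= e.
subst m; have eT : T = T' by exact: val_inj.
subst T'; case/or3P: (lexlt_total (leaf_depths U) (leaf_depths V)) => [lt|/eqP|gt].
- by left; apply: TripleLt => //; left.
- move=> /leaf_depths_inj eU; subst V; have npq : p <> q by move=> epq; apply: neq; rewrite epq.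
  have [lt|gt] := plt_total pp pq npq; [left|right]; apply: TripleLt => //; by right.
- by right; apply: TripleLt => //; left.
Qed.

Lemma triple_lt_mull z x y w : tcomp z x w -> triple_lt x y -> pure (tbraid z) ->
  exists2 w', tcomp z y w' & triple_lt w w'.
Proof.
case=> n W T U r p h pr; move ex: (Triple T p U) h => x' h.
case: h ex => m T' U' V p' q pp pq h ex.
have e := congr1 strands ex; rewrite /= in e; subst m.
have [eT ep eU] := triple_inj ex; subst T' p' U'; rewrite /= in pr.
exists (Triple W (r * q) V); first exact: TComp.
apply: TripleLt; [exact: pureM|exact: pureM|].
by case: h => [lt|[-> lt]]; [left|right; split=> //; exact: plt_mull].
Qed.

Definition depth_pairs (x : triple) : seq (nat * nat) :=
  zip (leaf_depths (tdom x)) (leaf_depths (tcod x)).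

Lemma zip_bump s t i : size s = size t ->
  bump_at bump2 i (zip s t) = zip (bump_at S i s) (bump_at S i t).
Proof.
by elim: s t i => [|x s IH] [|y t] [|i] //= [e]; rewrite IH.
Qed.

Lemma reach_refines x y : reach x y -> pure (tbraid x) ->
  refines (depth_pairs x) (depth_pairs y).
Proof.
elim=> [{}x _|{}x x1 {}y h _ IH px]; first exact: refines_refl.
have px1 := pure_reach (reach1 h) px; have {IH} := IH px1.
case: h px {px1} => n T U b i /= /eqP pb; rewrite /depth_pairs /= pb perm1 !leaf_depths_caret.
by rewrite -zip_bump ?size_leaf_depths //; exact: refines_bump.
Qed.

(** The second factors [z] and [z'] expand the same [z1], with first trees [U] and [V]. If these
    differ, a common expansion of [z] and [z'] makes [refines_lexlt] apply; if they coincide, then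
    [z = z'] and the braids decide. *)
Lemma triple_lt_mulr x y z z' w w' z1 : triple_lt x y ->
  tcomp x z w -> tcomp y z' w' -> reach z1 z -> reach z1 z' -> pure (tbraid z1) ->
  triple_lt w w'.
Proof.
move=> h; case: h => n T U V p q pp pq h.
move ex: (Triple T p U) => x' h1; case: h1 ex => m T1 U1 W p1 r ex.
have e := congr1 strands ex; rewrite /= in e; subst m.
have [eT ep eU] := triple_inj ex; subst T1 p1 U1.
move ey: (Triple T q V) => y' h2; case: h2 ey => m T2 V2 W' q2 r' ey.
have e := congr1 strands ey; rewrite /= in e; subst m.
have [eT eq eV] := triple_inj ey; subst T2 q2 V2.
move=> zr zr' pz; have pr := pure_reach zr pz; have pr' := pure_reach zr' pz.
rewrite /= in pr pr'.
apply: TripleLt; [exact: pureM|exact: pureM|].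
case: h => [lt|[eUV lt]].
  left; have [z0 zz0 zz0'] := reach_confl zr zr'.
  have := refines_lexlt (reach_refines zz0 pr) (reach_refines zz0' pr').
  by rewrite /depth_pairs /= !unzip1_zip ?unzip2_zip ?size_leaf_depths //; apply.
subst V; have [_ <- <-] := triple_inj (reach_dom_inj zr zr' erefl).
by right; split=> //; exact: plt_mulr.
Qed.

Definition bf_lt : rel BF := fun X Y =>
  `[< exists x y, [/\ bv_of x = val X, bv_of y = val Y & triple_lt x y] >].

Lemma bf_repr (X : BF) : exists2 x, bv_of x = val X & pure (tbraid x).
Proof.
by have /asboolP[n [T [U [p [pp e]]]]] := valP X; exists (Triple T p U).
Qed.

Lemma bf_mulE (X Y : BF) x y z : bv_of x = val X -> bv_of y = val Y -> tcomp x y z ->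
  bv_of z = val (X * Y).
Proof. by move=> ex ey h; rewrite -(bv_mulE h) ex ey. Qed.

Theorem theorem3p3 : bi_orderable BF.
Proof.
exists bf_lt; split.
- move=> X; apply/asboolP => -[x [y [ex ey h]]]; apply: (triple_lt_class h).
  by rewrite ex ey.
- move=> Y X Z /asboolP[x [y [ex ey h]]] /asboolP[y' [z [ey' ez h']]]; apply/asboolP.
  have /bv_of_reach[w yw y'w] : bv_of y = bv_of y' by rewrite ey.
  have [x1 xx1 h1] := triple_lt_reachr h yw; have [z1 zz1 h2] := triple_lt_reachl h' y'w.
  exists x1, z1; rewrite -(reach_bv xx1) -(reach_bv zz1); split=> //.
  exact: triple_lt_trans h2.
- move=> X Y XY; have [x ex px] := bf_repr X; have [y ey py] := bf_repr Y.
  (* Expansion to the join of the first trees makes the two elements comparable. *)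
  have [x1 xx1 ex1] := lift_dom (tree_joinl (val (tdom x)) (val (tdom y))).
  have [y1 yy1 ey1] := lift_dom (tree_joinr (val (tdom x)) (val (tdom y))).
  rewrite (reach_bv xx1) in ex; rewrite (reach_bv yy1) in ey.
  have [||||h|h] := @triple_total x1 y1.
  + by rewrite ex1.
  + exact: pure_reach px.
  + exact: pure_reach py.
  + by move=> e; case/eqP: XY; apply: val_inj; rewrite -ex -ey e.
  + by apply/orP; left; apply/asboolP; exists x1, y1.
  + by apply/orP; right; apply/asboolP; exists y1, x1.
- move=> X Y Z /asboolP[x [y [ex ey h]]]; have [z ez pz] := bf_repr Z; split; apply/asboolP.
  + have [z1 [x1 [w [zz1 xx1 c]]]] := tcomp_reach_ex z x.
    have [y1 yy1 h1] := triple_lt_reachl h xx1.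
    have [w' c' h'] := triple_lt_mull c h1 (pure_reach zz1 pz).
    exists w, w'; split=> //.
      by apply: bf_mulE c; rewrite -?(reach_bv zz1) -?(reach_bv xx1).
    by apply: bf_mulE c'; rewrite -?(reach_bv zz1) -?(reach_bv yy1).
  + have [x1 [z1 [w1 [xx1 zz1 c1]]]] := tcomp_reach_ex x z.
    have [y1 yy1 h1] := triple_lt_reachl h xx1.
    (* Composing [y1] with [z1] may force a further expansion; it is carried back to [x1] and then
       over to [z1], so the products use two expansions [z3] and [z2] of [z1]. *)
    have [y2 [z2 [w2 [yy2 zz2 c2]]]] := tcomp_reach_ex y1 z1.
    have [x2 xx2 h2] := triple_lt_reachr h1 yy2.
    have [z3 [w3 [zz3 _ c3]]] := tcomp_reachl c1 xx2.
    exists w3, w2; split.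
    * by apply: bf_mulE c3; rewrite -?(reach_bv xx2) -?(reach_bv xx1)
        -?(reach_bv zz3) -?(reach_bv zz1).
    * by apply: bf_mulE c2; rewrite -?(reach_bv yy2) -?(reach_bv yy1)
        -?(reach_bv zz2) -?(reach_bv zz1).
    * exact: triple_lt_mulr h2 c3 c2 zz3 zz2 (pure_reach zz1 pz).
Qed.
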